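(* Let $n\ge 3$ be an integer, let $r>0$, let $\overline B_r\subset\mathbb R^n$ be a closed ball of radius $r$, and let $f:\overline B_r\to\mathbb R$ be a $C^2$ function. Let $M=\{(x,f(x)) : x\in\overline B_r\}\subset\mathbb R^{n+1}$ be its graph. If the Ricci curvature of $M$ is negative (at every point and in every tangent direction), then $$\inf_M|A|<\frac{3(n-2)}{r},$$ where $|A|$ is the length of the second fundamental form of $M$ in $\mathbb R^{n+1}$.
   Context: A $C^2$ function on a closed ball is understood to be $C^2$ up to the boundary (i.e. it is the restriction of a $C^2$ function defined on an open neighborhood of the closed ball). The graph $M$ is oriented by a choice of continuous unit normal field. Let $A$ denote the shape operator of $M$ and $k_1(p)\le\dots\le k_n(p)$ the principal curvatures (eigenvalues of $A$) at $p\in M$. The length of the second fundamental form is $|A|(p)=\big(\operatorname{trace}A^2(p)\big)^{1/2}=\big(\sum_{i=1}^n k_i(p)^2\big)^{1/2}$, and the mean curvature is $H=\frac1n\sum_{i=1}^n k_i$. If $e_1,\dots,e_n$ is an orthonormal basis of $T_pM$ with $A(e_i)=k_ie_i$, the (normalized) Ricci curvature is given by the Gauss equation as $(n-1)\operatorname{Ric}_p(e_i)=\sum_{j\ne i}k_ik_j=k_i(nH-k_i)$; for a general unit vector $v\in T_pM$, $(n-1)\operatorname{Ric}_p(v)=nH\langle Av,v\rangle-\|Av\|^2$. Negative Ricci curvature means $\operatorname{Ric}_p(v)<0$ for all $p\in M$ and all unit $v\in T_pM$; equivalently, $k_i(nH-k_i)<0$ for all $i$ at every point of $M$. *)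

(* Defs.v *)
From HB Require Import structures.
From mathcomp Require Import all_boot all_order all_algebra.
From mathcomp Require Import all_classical all_reals all_analysis.

Set Implicit Arguments.
Unset Strict Implicit.
Unset Printing Implicit Defensive.

Import Order.TTheory GRing.Theory Num.Theory.
Import numFieldNormedType.Exports.

Local Open Scope classical_set_scope.
Local Open Scope ring_scope.

Section Euclidean.
Context {R : realType} {m : nat}.
Implicit Types (u v : 'rV[R]_m).

Definition dot u v : R := \sum_i u 0 i * v 0 i.

(* The library norm `|u| on 'rV[R]_m is the sup norm, which induces the same
   topology and the same differentials but not the Euclidean balls. *)
Definition enorm u : R := Num.sqrt (dot u u).

Definition closed_eball (c : 'rV[R]_m) (r : R) : set 'rV[R]_m :=
  [set x | enorm (x - c) <= r].

End Euclidean.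

Section Smoothness.
Context {R : realType} {m : nat}.
Implicit Types (U : set 'rV[R]_m) (g : 'rV[R]_m -> R).

Definition C1_on U g :=
  (forall x, U x -> differentiable g x) /\
  (forall v x, U x -> {for x, continuous (fun y => 'D_v g y)}).

Definition C2_on U g :=
  C1_on U g /\ (forall v, C1_on U (fun y => 'D_v g y)).

End Smoothness.

Section Graph.
Context {R : realType} {n : nat}.
Implicit Types (U : set 'rV[R]_n) (f : 'rV[R]_n -> R)
  (N : 'rV[R]_n -> 'rV[R]_(n + 1)) (x v : 'rV[R]_n).

Definition graph_map f x : 'rV[R]_(n + 1) := row_mx x (f x)%:M.

(* The tangent vector 'd (graph_map f) x v at p = (x, f x).  A vector v of R^n
   is thus used as the list of coordinates of a vector of T_pM in the frame
   given by the rows of 'J (graph_map f) x. *)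
Definition tangent f x v : 'rV[R]_(n + 1) := v *m 'J (graph_map f) x.

(* N x is the normal at the point (x, f x). *)
Definition unit_normal_field U f N :=
  forall x, U x ->
    [/\ {for x, continuous N}, enorm (N x) = 1
      & forall v, dot (N x) (tangent f x v) = 0].

(* Matrix of the shape operator A = - dN on T_pM in the above frame, acting on
   row vectors of coordinates: row i of - 'J N x is A applied to the i-th vector
   of the frame, and, since it is tangent and the frame is free, pinvmx returns
   its coordinates. *)
Definition shape_mx f N x : 'M[R]_n :=
  (- 'J N x) *m pinvmx ('J (graph_map f) x).

Definition shape_op f N x v : 'rV[R]_n := v *m shape_mx f N x.

(* The eigenvalues of A, with multiplicity, in nondecreasing order.  A is
   self-adjoint for the inner product of T_pM, so this list exists (and it is
   unique): the default value [::] is not used on a C^2 graph. *)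
Definition principal_curvatures f N x : seq R :=
  xget [::] [set ks : seq R | sorted <=%R ks /\
    char_poly (shape_mx f N x) = \prod_(k <- ks) ('X - k%:P)].

Definition mean_curvature f N x : R :=
  (\sum_(k <- principal_curvatures f N x) k) / n%:R.

Definition sff_length f N x : R :=
  Num.sqrt (\tr (shape_mx f N x *m shape_mx f N x)).

(* Normalized Ricci curvature of the tangent vector with coordinates v, through
   the Gauss equation (the induced metric being only C^1, there is no intrinsic
   curvature tensor to start from); meaningful when that vector is a unit one. *)
Definition ricci f N x v : R :=
  let X := tangent f x v in
  let AX := tangent f x (shape_op f N x v) in
  (n%:R * mean_curvature f N x * dot AX X - enorm AX ^+ 2) / (n%:R - 1).

Definition negative_ricci (B : set 'rV[R]_n) f N :=
  forall x, B x -> forall v, enorm (tangent f x v) = 1 -> ricci f N x v < 0.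

End Graph.

(* Main.v *)
(* Orient the graph upwards and let k_i be its principal curvatures. Lower onto
   the graph a hemisphere of radius r lying above it: being vertical along its
   boundary, it first touches the graph at an interior point, and there
   k_i <= 1/r for all i. Negative Ricci curvature reads
   k_i (k_1 + ... + k_n - k_i) < 0, so no k_i vanishes, and, with alpha the sum
   of the positive k_i, the absolute values of the negative ones, any one of
   them being left out, add up to less than alpha. If there are at least two
   negative k_i, each is then smaller than alpha in absolute value, their
   squares add up to at most 2 alpha^2, and alpha <= (n - 2)/r; hence
   |A|^2 <= 3 (n - 2)^2 / r^2 at the contact point. As no k_i vanishes, the number
   of negative ones is constant on the ball; if it is less than two, at least two
   are positive because n >= 3, and the same argument applies to a hemisphere
   lifted from below. *)
Require Import Defs.
From mathcomp Require Import all_boot all_order all_algebra.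
From mathcomp Require Import all_classical all_reals all_analysis.
From mathcomp Require Import ring lra.
Set Implicit Arguments.
Unset Strict Implicit.
Unset Printing Implicit Defensive.
Import Order.TTheory GRing.Theory Num.Theory.
Import numFieldNormedType.Exports.
Local Open Scope classical_set_scope.
Local Open Scope ring_scope.

(** * Real spectral theorem *)

Section DotProduct.
Context {R : realType} {m : nat}.
Implicit Types (u v w : 'rV[R]_m).

Lemma dotE u v : dot u v = (u *m v^T) 0 0.
Proof. by rewrite /dot mxE; apply: eq_bigr => i _; rewrite mxE. Qed.

Lemma dotC u v : dot u v = dot v u.
Proof. by apply: eq_bigr => i _; rewrite mulrC. Qed.

Lemma dotDl u v w : dot (u + v) w = dot u w + dot v w.
Proof. by rewrite !dotE mulmxDl mxE. Qed.

Lemma dotZl a u v : dot (a *: u) v = a * dot u v.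
Proof. by rewrite !dotE -scalemxAl mxE. Qed.

Lemma dotNl u v : dot (- u) v = - dot u v.
Proof. by rewrite -scaleN1r dotZl mulN1r. Qed.

Lemma dotDr u v w : dot u (v + w) = dot u v + dot u w.
Proof. by rewrite dotC dotDl !(dotC _ u). Qed.

Lemma dotZr a u v : dot u (a *: v) = a * dot u v.
Proof. by rewrite dotC dotZl dotC. Qed.

Lemma dotNr u v : dot u (- v) = - dot u v.
Proof. by rewrite dotC dotNl dotC. Qed.

Lemma dotBl u v w : dot (u - v) w = dot u w - dot v w.
Proof. by rewrite dotDl dotNl. Qed.

Lemma dotBr u v w : dot u (v - w) = dot u v - dot u w.
Proof. by rewrite dotDr dotNr. Qed.

Lemma dot_ge0 u : 0 <= dot u u.
Proof. by apply: sumr_ge0 => i _; rewrite -expr2 sqr_ge0. Qed.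

Lemma dot_eq0 u : (dot u u == 0) = (u == 0).
Proof.
apply/eqP/eqP => [/eqP|->]; last by rewrite dotE mul0mx mxE.
rewrite /dot psumr_eq0 => [/allP uu0|i _]; last by rewrite -expr2 sqr_ge0.
apply/rowP => i; rewrite mxE.
have /eqP := uu0 i (mem_index_enum i).
by rewrite -expr2 => /eqP; rewrite sqrf_eq0 => /eqP.
Qed.

Lemma dot_gt0 u : (0 < dot u u) = (u != 0).
Proof. by rewrite lt_neqAle dot_ge0 andbT eq_sym dot_eq0. Qed.

Lemma sqr_enorm u : enorm u ^+ 2 = dot u u.
Proof. by rewrite sqr_sqrtr ?dot_ge0. Qed.

Lemma enorm_le u (a : R) : 0 <= a -> (enorm u <= a) = (dot u u <= a ^+ 2).
Proof.
by move=> a0; rewrite -sqr_enorm ler_pXn2r ?nnegrE ?sqrtr_ge0.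
Qed.

Lemma sqr_coord_le u i : u 0 i ^+ 2 <= dot u u.
Proof.
rewrite /dot (bigD1 i)//= -expr2 lerDl.
by apply: sumr_ge0 => j _; rewrite -expr2 sqr_ge0.
Qed.

Lemma dot_delta u i : dot u (delta_mx 0 i) = u 0 i.
Proof.
rewrite /dot (bigD1 i)//= mxE !eqxx mulr1 big1 ?addr0// => j ji.
by rewrite mxE (negbTE ji) andbF mulr0.
Qed.

End DotProduct.

Lemma dot_mulmxl {R : realType} {m p} (x : 'rV[R]_p) (A : 'M[R]_(p, m))
    (u : 'rV[R]_m) :
  dot (x *m A) u = dot x (u *m A^T).
Proof. by rewrite !dotE trmx_mul trmxK mulmxA. Qed.

(** * Continuity of matrix expressions and compactness of Euclidean balls *)

Section Continuity.
Context {R : realType}.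

Lemma continuous_sum {T : topologicalType} {I : Type} (r : seq I)
    (F : I -> T -> R) (x : T) :
  (forall i, {for x, continuous (F i)}) ->
  {for x, continuous (fun y => \sum_(i <- r) F i y)}.
Proof.
move=> cF; elim: r => [|i r IH].
  rewrite (_ : (fun _ => _) = cst 0); first exact: cst_continuous.
  by apply/funext => y; rewrite big_nil.
rewrite (_ : (fun _ => _) = F i \+ (fun y => \sum_(j <- r) F j y)).
  by apply: continuousD => //; exact: cF.
by apply/funext => y; rewrite big_cons.
Qed.

Lemma continuous_mx {m n} {T : topologicalType} (M : T -> 'M[R]_(m, n)) x :
  (forall i j, {for x, continuous (fun y => M y i j)}) ->
  {for x, continuous M}.
Proof.
move=> cM V [P nP PV]; apply: filterS PV _.
by apply: filter_forall => i; apply: filter_forall => j; exact: cM.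
Qed.

Lemma continuous_mulmxr {m n p} (A : 'M[R]_(n, p)) :
  continuous (fun v : 'M[R]_(m, n) => v *m A).
Proof.
move=> v; apply: continuous_mx => i j.
rewrite (_ : (fun _ => _) = fun y : 'M[R]_(m, n) => \sum_k y i k * A k j); last first.
  by apply/funext => y; rewrite mxE.
apply: continuous_sum => k; apply: continuousM; last exact: cst_continuous.
exact: coord_continuous.
Qed.

Lemma continuous_mulmx {m n p} (A : 'M[R]_(m, n)) :
  continuous (fun v : 'M[R]_(n, p) => A *m v).
Proof.
move=> v; apply: continuous_mx => i j.
rewrite (_ : (fun _ => _) = fun y : 'M[R]_(n, p) => \sum_k A i k * y k j); last first.
  by apply/funext => y; rewrite mxE.
apply: continuous_sum => k; apply: continuousM; first exact: cst_continuous.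
exact: coord_continuous.
Qed.

Lemma continuous_dot {m} {T : topologicalType} (u v : T -> 'rV[R]_m) x :
  {for x, continuous u} -> {for x, continuous v} ->
  {for x, continuous (fun y => dot (u y) (v y))}.
Proof.
move=> cu cv; apply: continuous_sum => i.
apply: continuousM.
- apply: (@continuous_comp _ _ _ u (fun M : 'rV[R]_m => M 0 i)) => //.
  exact: coord_continuous.
- apply: (@continuous_comp _ _ _ v (fun M : 'rV[R]_m => M 0 i)) => //.
  exact: coord_continuous.
Qed.

Lemma closed_eball_compact {m} (c : 'rV[R]_m) r : compact (closed_eball c r).
Proof.
have [r0|r0] := ltP r 0.
  rewrite (_ : closed_eball c r = set0); first exact: compact0.
  apply/seteqP; split => // x /=; rewrite /closed_eball/= => xr.
  by have := le_lt_trans xr r0; rewrite ltNge sqrtr_ge0.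
apply: bounded_closed_compact.
  exists (r + `|c|); split; first exact: num_real.
  move=> M rM x; rewrite /closed_eball/= enorm_le// => xr.
  apply: ltW; apply: le_lt_trans rM.
  rewrite -[x](subrK c); apply: le_trans (ler_normD _ _) _.
  rewrite lerD2r [leLHS]mx_normrE.
  apply: bigmax_le => // -[i j] _ /=.
  rewrite ord1 -(ger0_norm r0) -ler_sqr ?nnegrE// !real_normK ?num_real//.
  exact: le_trans (sqr_coord_le _ _) xr.
rewrite (_ : closed_eball c r = (fun x => dot (x - c) (x - c)) @^-1` [set y | y <= r ^+ 2]).
  apply: preimage_closed; last exact: closed_le.
  move=> x _; have cB : {for x, continuous (fun y : 'rV[R]_m => y - c)}.
    by apply: continuousB => //; exact: cst_continuous.
  exact: (continuous_dot cB cB).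
by apply/seteqP; split => x /=; rewrite /closed_eball/= enorm_le.
Qed.

End Continuity.

(** * Diagonalization of symmetric matrices *)

Section Spectral.
Context {R : realType}.

(** If [w = v *m A] were nonzero, a small move from [v] along [- w] would make the form negative,
    since its first-order variation there is [- 2 * dot w w]. *)
Lemma psd_kernel m (A : 'M[R]_m) v :
  A^T = A -> (forall u, 0 <= dot (u *m A) u) -> dot (v *m A) v = 0 ->
  v *m A = 0.
Proof.
move=> As A0 vA0; pose w := v *m A; apply/eqP.
rewrite -/w -dot_eq0 eq_le dot_ge0 andbT leNgt; apply/negP => w0.
set a := dot w w in w0; set b := dot (w *m A) w.
have b0 : 0 <= b := A0 w.
have b1 : 0 < b + 1 by rewrite ltr_wpDl.
have wv : dot (w *m A) v = a by rewrite dot_mulmxl As.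
(* The [+ 1] keeps the step length meaningful when [b = 0]. *)
have := A0 (v - (a / (b + 1)) *: w).
rewrite mulmxBl -scalemxAl -/w !(dotBl, dotBr, dotZl, dotZr).
rewrite vA0 wv -/a -/b.
rewrite (_ : _ - _ = - (a ^+ 2 * (b + 2)) / (b + 1) ^+ 2); last first.
  by field; rewrite gt_eqF.
rewrite ler_pdivlMr ?exprn_gt0//.
by rewrite mul0r oppr_ge0 leNgt mulr_gt0// ?exprn_gt0// ltr_wpDl.
Qed.

(* A maximiser of the Rayleigh quotient is an eigenvector. *)
Lemma symmetric_eigenvector m (A : 'M[R]_m.+1) : A^T = A ->
  exists a v, dot v v = 1 /\ v *m A = a *: v.
Proof.
move=> As; pose S := [set v : 'rV[R]_m.+1 | dot v v = 1].
have cS : compact S.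
  apply: (subclosed_compact _ (@closed_eball_compact _ m.+1 0 1)).
    rewrite (_ : S = (fun x => dot x x) @^-1` [set 1]) //.
    apply: preimage_closed; last exact: closed_eq.
    by move=> x _; apply: continuous_dot.
  by move=> v /=; rewrite /closed_eball/= subr0 enorm_le// => ->; rewrite expr1n.
have [||v] := @compact_EVT_max _ _ (fun v : 'rV[R]_m.+1 => dot (v *m A) v) S _ cS.
- exists (delta_mx 0 ord0); rewrite /S/= dot_delta mxE !eqxx//.
- apply: continuous_subspaceT => x.
  have cA := @continuous_mulmxr _ 1 _ _ A x.
  by apply: (continuous_dot cA) => //; exact: cvg_id.
rewrite inE /S/= => v1 vmax; exists (dot (v *m A) v), v; split=> //.
set a := dot _ v.
(* By maximality [a%:M - A] is positive semidefinite, and its form vanishes at [v]. *)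
suff /eqP : v *m (a%:M - A) = 0.
  by rewrite mulmxBr mul_mx_scalar subr_eq0 => /eqP.
apply: psd_kernel.
- by rewrite linearB/= tr_scalar_mx As.
- move=> u; rewrite mulmxBr mul_mx_scalar dotBl dotZl subr_ge0.
  have [->|u0] := eqVneq u 0; first by rewrite mul0mx !dotE trmx0 !mulmx0 mxE mulr0.
  have uu : 0 < dot u u by rewrite dot_gt0.
  have := vmax ((Num.sqrt (dot u u))^-1 *: u).
  rewrite inE/= -!scalemxAl !(dotZl, dotZr) !mulrA -invfM -expr2 sqr_sqrtr ?dot_ge0//.
  by rewrite mulVf ?gt_eqF// => /(_ erefl); rewrite ler_pdivrMl// mulrC.
- by rewrite mulmxBr mul_mx_scalar dotBl dotZl v1 mulr1 subrr.
Qed.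

(* Q is the reflection exchanging u and the first basis vector. *)
Lemma orthogonal_completion m (u : 'rV[R]_m.+1) : dot u u = 1 ->
  exists Q : 'M[R]_m.+1, Q *m Q^T = 1%:M /\ row 0 Q = u.
Proof.
move=> u1; pose e : 'rV[R]_m.+1 := delta_mx 0 0.
have [->|une] := eqVneq u e.
  by exists 1%:M; rewrite trmx1 mulmx1 row1.
pose w := u - e.
have w0 : 0 < dot w w by rewrite dot_gt0 subr_eq0.
have e1 : dot e e = 1 by rewrite dot_delta mxE !eqxx.
have ww : dot w w = - 2 * dot w e.
  by rewrite /w !(dotBl, dotBr) u1 e1 (dotC e u); ring.
pose Q := 1%:M - (2 / dot w w) *: (w^T *m w).
have Qs : Q^T = Q.
  by rewrite /Q linearB/= linearZ/= trmx_mul trmxK trmx1.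
have wwE : w *m w^T = (dot w w)%:M.
  by rewrite [LHS]mx11_scalar -dotE.
have wQ : w *m Q = - w.
  rewrite mulmxBr mulmx1 -scalemxAr mulmxA wwE mul_scalar_mx scalerA.
  by rewrite divfK ?gt_eqF// scaler_nat mulr2n opprD addNKr.
exists Q; rewrite Qs; split.
  rewrite {1}/Q mulmxBl mul1mx -scalemxAl -mulmxA wQ mulmxN scalerN opprK.
  by rewrite /Q subrK.
rewrite rowE -/e mulmxBr mulmx1 -scalemxAr mulmxA.
have -> : e *m w^T = (dot w e)%:M by rewrite dotC dotE -mx11_scalar.
have we0 : dot w e != 0.
  by apply: contraTneq w0 => we0; rewrite ww we0 mulr0 ltxx.
rewrite mul_scalar_mx scalerA ww (_ : 2 / (- 2 * dot w e) * dot w e = - 1); last by field.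
by rewrite scaleN1r opprK addrC subrK.
Qed.

(** Induction on the size: conjugation by an orthogonal [P] whose first row is an eigenvector splits
    off a block of size one. *)
Lemma spectral_theorem m (A : 'M[R]_m) : A^T = A ->
  exists (Q : 'M[R]_m) (d : 'rV[R]_m), Q *m Q^T = 1%:M /\ Q *m A *m Q^T = diag_mx d.
Proof.
elim: m A => [|m IH] A As.
  by exists 1%:M, 0; split; apply/matrixP => -[].
have [a [v [v1 vA]]] := symmetric_eigenvector As.
have [P [PP rP]] := orthogonal_completion v1.
have [B BE] : exists B : 'M[R]_(1 + m), B = P *m A *m P^T by eexists.
have Bs : B^T = B by rewrite BE !trmx_mul trmxK As mulmxA.
have rB : row 0 B = a *: delta_mx 0 0.
  rewrite BE !row_mul rP vA -scalemxAl; congr (_ *: _).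
  by rewrite -rP -row_mul PP row1.
(* The eigenvector gives the first row of [B], and symmetry the first column. *)
have Bb : B = block_mx a%:M 0 0 (drsubmx B).
  have l0 : lshift m (0 : 'I_1) = 0 :> 'I_m.+1 by apply: val_inj.
  have B0 j : B (lshift m 0) j = a *+ (j == lshift m 0).
    by have /rowP/(_ j) := rB; rewrite -l0 !mxE eqxx/= mulr_natr.
  rewrite -[LHS]submxK; congr block_mx.
  - by apply/matrixP => i j; rewrite !ord1 !mxE B0 eqxx.
  - by apply/matrixP => i j; rewrite !ord1 !mxE B0 eq_rlshift.
  - by apply/matrixP => i j; rewrite !ord1 !mxE -Bs mxE B0 eq_rlshift.
have [|Q [d [QQ QA]]] := IH (drsubmx B).
  by rewrite trmx_drsub Bs.
pose Q1 : 'M[R]_(1 + m) := block_mx 1%:M 0 0 Q.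
have Q1T : Q1^T = block_mx 1%:M 0 0 Q^T.
  by rewrite /Q1 tr_block_mx trmx1 !trmx0.
have QQ1 : Q1 *m Q1^T = 1%:M.
  rewrite Q1T mulmx_block !(mul0mx, mulmx0, mul1mx) !addr0 add0r QQ.
  by rewrite -scalar_mx_block.
have QB : Q1 *m B *m Q1^T = diag_mx (row_mx a%:M d).
  rewrite Bb Q1T !mulmx_block !(mul0mx, mulmx0, mul1mx, mulmx1, addr0, add0r).
  rewrite QA diag_mx_row; congr block_mx.
  by apply/matrixP => i j; rewrite !ord1 !mxE eqxx.
exists (Q1 *m P), (row_mx a%:M d); split.
  by rewrite trmx_mul mulmxA -(mulmxA Q1) PP mulmx1.
by rewrite -QB BE trmx_mul !mulmxA.
Qed.

(** Diagonalize [G] by [P], rescale it to the identity by [D], then diagonalize the transformed [A]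
    by an orthogonal [Q], which preserves the identity. For [G] the metric and [A] the Hessian, the
    rows of [E] are orthonormal principal directions. *)
Lemma simultaneous_diagonalization m (G A : 'M[R]_m) :
  G^T = G -> A^T = A -> (forall u, u != 0 -> 0 < dot (u *m G) u) ->
  exists (E : 'M[R]_m) (d : 'rV[R]_m),
    E *m G *m E^T = 1%:M /\ E *m A *m E^T = diag_mx d.
Proof.
move=> Gs As Gpos.
have [P [g [PP PG]]] := spectral_theorem Gs.
have g0 i : 0 < g 0 i.
  have : 0 < dot (row i P *m G) (row i P).
    apply: Gpos; apply/eqP => rP0.
    have /rowP/(_ i) : row i (P *m P^T) = 0 by rewrite row_mul rP0 mul0mx.
    by rewrite PP !mxE eqxx => /eqP; rewrite oner_eq0.
  rewrite dotE -row_mul.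
  suff -> : (row i (P *m G) *m (row i P)^T) 0 0 = (P *m G *m P^T) i i.
    by rewrite PG mxE eqxx.
  by rewrite -[RHS]/((P *m G *m P^T) i i) tr_row !mxE; apply: eq_bigr => j _; rewrite !mxE.
pose D := diag_mx (\row_i (Num.sqrt (g 0 i))^-1).
have DT : D^T = D by rewrite tr_diag_mx.
have [|Q [d [QQ QA]]] := @spectral_theorem _ (D *m P *m A *m P^T *m D).
  by rewrite !trmx_mul trmxK DT As !mulmxA.
exists (Q *m D *m P), d; split; last first.
  by rewrite -QA !trmx_mul DT !mulmxA.
rewrite !trmx_mul DT.
transitivity (Q *m (D *m (P *m G *m P^T) *m D) *m Q^T).
  by rewrite !mulmxA.
rewrite PG (_ : D *m diag_mx g *m D = 1%:M) ?mulmx1//.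
rewrite !mulmx_diag; apply/matrixP => i j; rewrite !mxE mulrAC -invfM -expr2.
by rewrite sqr_sqrtr ?ltW// mulVf// lt0r_neq0.
Qed.

End Spectral.

(** * Principal curvatures *)

(** The algebraic core, used with [s = 1/r]. The positive parts [a] and negative parts [b], with
    sums [al] and [be], satisfy [\sum a^2 <= s * al], [\sum b^2 <= 2 * al^2] and
    [al <= (n - 2) * s]. *)
Lemma curvature_sum_le {R : realType} n (k : 'I_n -> R) (s : R) (i j : 'I_n) :
  (forall l, k l * (\sum_m k m - k l) < 0) -> (forall l, k l <= s) ->
  i != j -> k i < 0 -> k j < 0 -> (3 <= n)%N ->
  \sum_l k l ^+ 2 <= 3 * (n%:R - 2) ^+ 2 * s ^+ 2.
Proof.
move=> ric ks ij ki kj n3.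
pose a l := Num.max (k l) 0; pose b l := Num.max (- k l) 0.
have kE l : k l = a l - b l.
  by rewrite /a /b; case: (leP (k l) 0); case: (leP (- k l) 0); lra.
have a0 l : 0 <= a l by rewrite /a le_max lexx orbT.
have b0 l : 0 <= b l by rewrite /b le_max lexx orbT.
have sqE l : k l ^+ 2 = a l ^+ 2 + b l ^+ 2.
  rewrite /a /b; case: (leP (k l) 0); case: (leP (- k l) 0) => h1 h2.
  - by have -> : k l = 0 by [lra]; ring.
  - by ring.
  - by ring.
  - by exfalso; lra.
pose al := \sum_l a l; pose be := \sum_l b l.
have TE : \sum_m k m = al - be.
  by rewrite /al /be -sumrB; apply: eq_bigr.
(* For negative [k l] the Ricci condition forces [\sum_m k m - k l > 0]. *)
have neg l : k l < 0 -> be - b l < al.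
  move=> kl; have := ric l; rewrite nmulr_rlt0// TE.
  have : b l = - k l by rewrite /b max_l; lra.
  lra.
have bD l m : l != m -> b l <= be - b m.
  move=> lm; rewrite /be (bigD1 m)//= addrAC subrr add0r (bigD1 l)//= lerDl.
  exact: sumr_ge0.
(* Leave out whichever of the two negative indices differs from [l]. *)
have blt l : b l < al.
  have [->|lj] := eqVneq l j; last exact: le_lt_trans (bD _ _ lj) (neg _ kj).
  by apply: le_lt_trans (neg _ ki); apply: bD; rewrite eq_sym.
have al0 : 0 < al by apply: le_lt_trans (blt i).
have s0 : 0 <= s.
  rewrite leNgt; apply/negP => s0; move: al0; rewrite /al big1 ?ltxx// => l _.
  by rewrite /a max_r// (le_trans (ks l))// ltW.
have aS l : a l <= s by rewrite /a ge_max ks.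
have ai l : k l < 0 -> a l = 0 by move=> kl; rewrite /a max_r// ltW.
(* Since [a] vanishes at [i] and [j], only [n - 2] terms remain. *)
have als : al <= (n%:R - 2) * s.
  rewrite /al (bigD1 i)//= (bigD1 j) 1?eq_sym//= !ai// !add0r.
  apply: le_trans (ler_sum _ (fun l _ => aS l)) _.
  rewrite sumr_const.
  suff -> : n%:R - 2 = #|[pred l | (l != i) && (l != j)]|%:R :> R.
    by rewrite mulr_natl.
  have cE : #|[pred l | (l != i) && (l != j)]| = #|predC (pred2 i j)|.
    by apply: eq_card => l; rewrite !inE negb_or.
  have := cardC (pred2 i j); rewrite card2 ij card_ord -cE /= => nE.
  by rewrite -[X in X%:R - _]nE natrD addrAC subrr add0r.
(* The term at [i] is at most [al^2], the others together at most [al * (be - b i) <= al^2]. *)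
have sumb : \sum_l b l ^+ 2 <= 2 * al ^+ 2.
  rewrite (bigD1 i)//=.
  have : \sum_(l < n | l != i) b l ^+ 2 <= al * \sum_(l < n | l != i) b l.
    rewrite mulr_sumr; apply: ler_sum => l _.
    by rewrite expr2 ler_wpM2r// ltW.
  have : \sum_(l < n | l != i) b l = be - b i.
    by rewrite /be [X in _ = X - _](bigD1 i)//= addrAC subrr add0r.
  move=> ->; have := neg _ ki; have := blt i; have := b0 i; nra.
have suma : \sum_l a l ^+ 2 <= s * al.
  rewrite mulr_sumr; apply: ler_sum => l _.
  by rewrite expr2 ler_wpM2r.
have m1 : 1 <= n%:R - 2 :> R.
  by rewrite lerBrDr -(natrD _ 1 2) ler_nat.
under eq_bigr do rewrite sqE.
rewrite big_split/=; apply: le_trans (lerD suma sumb) _.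
have : s * al <= s * ((n%:R - 2) * s) by rewrite ler_wpM2l.
have : al ^+ 2 <= ((n%:R - 2) * s) ^+ 2 by rewrite ler_pXn2r ?nnegrE// ltW// (lt_le_trans al0).
(* As [m >= 1], the bound [m * s^2 + 2 * m^2 * s^2] is at most [3 * m^2 * s^2]. *)
move: m1; set m := n%:R - 2 => m1; have : 0 <= s ^+ 2 by rewrite sqr_ge0.
rewrite exprMn; have : m <= m ^+ 2 by nra.
nra.
Qed.

(** * Curvatures read in an orthonormal principal frame *)

Section PrincipalFrame.
Context {R : realType} {n : nat} (f : 'rV[R]_n -> R)
  (N : 'rV[R]_n -> 'rV[R]_(n + 1)) (x : 'rV[R]_n).
Local Notation P := ('J (graph_map f) x).
Local Notation S := (shape_mx f N x).

(** The first fundamental form: the Gram matrix of the coordinate frame of the graph. *)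
Definition metric_mx : 'M[R]_n := P *m P^T.

Lemma dot_tangent u v : dot (tangent f x u) (tangent f x v) = dot (u *m metric_mx) v.
Proof. by rewrite /tangent /metric_mx !dotE trmx_mul !mulmxA. Qed.

(** The rows of [E] are the coordinates of an orthonormal basis of eigenvectors of the shape
    operator, with eigenvalues [k]. *)
Variables (E : 'M[R]_n) (k : 'rV[R]_n).
Hypotheses (EG : E *m metric_mx *m E^T = 1%:M) (ES : E *m S = diag_mx k *m E).

Lemma frame_unit : E \in unitmx.
Proof. by have [] := mulmx1_unit EG; rewrite unitmx_mul => /andP[]. Qed.

Lemma frame_norm i : dot (tangent f x (row i E)) (tangent f x (row i E)) = 1.
Proof.
transitivity ((E *m metric_mx *m E^T) i i); last by rewrite EG mxE eqxx.
rewrite dot_tangent dotE -row_mul tr_row mxE [RHS]mxE.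
by apply: eq_bigr => j _; rewrite !mxE.
Qed.

Lemma shape_mxE : S = invmx E *m diag_mx k *m E.
Proof. by rewrite -mulmxA -ES mulKmx ?frame_unit. Qed.

Lemma tr_shape_mx : \tr S = \sum_i k 0 i.
Proof.
rewrite shape_mxE -mulmxA mxtrace_mulC -mulmxA mulmxV ?frame_unit// mulmx1.
exact: mxtrace_diag.
Qed.

Lemma tr_shape_mx2 : \tr (S *m S) = \sum_i k 0 i ^+ 2.
Proof.
rewrite shape_mxE -!mulmxA mulKVmx ?frame_unit// mxtrace_mulC -!mulmxA.
rewrite mulmxV ?frame_unit// mulmx1 mulmx_diag mxtrace_diag.
by apply: eq_bigr => i _; rewrite mxE expr2.
Qed.

Lemma char_poly_shape_mx : char_poly S = \prod_i ('X - (k 0 i)%:P).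
Proof.
have -> : char_poly S = char_poly (diag_mx k).
  rewrite /char_poly /char_poly_mx shape_mxE !map_mxM/= map_invmx.
  set F := map_mx polyC E; have Fu : F \in unitmx by rewrite map_unitmx frame_unit.
  rewrite (_ : _ - _ = invmx F *m ('X%:M - map_mx polyC (diag_mx k)) *m F); last first.
    by rewrite mulmxBr mulmxBl scalar_mxC mulmxKV.
  by rewrite !det_mulmx mulrAC -det_mulmx mulVmx// det1 mul1r.
rewrite char_poly_trig ?diag_mx_is_trig//.
by apply: eq_bigr => i _; rewrite mxE eqxx.
Qed.

(** The chosen list is not compared with [k]: its sum is read off the coefficient of degree [n - 1]
    of the characteristic polynomial, which is minus the trace. *)
Lemma sum_principal_curvatures : (0 < n)%N ->
  \sum_(t <- principal_curvatures f N x) t = \tr S.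
Proof.
move=> n0; rewrite /principal_curvatures; case: xgetP => [ks _ [_ ksE]|noks]; last first.
  (* Sorting the entries of [k] gives an admissible list, which rules out the default value. *)
  exfalso; apply: (noks (sort <=%R [seq k 0 i | i <- enum 'I_n])); split.
    exact: sort_sorted le_total _.
  rewrite char_poly_shape_mx (perm_big _ (permEl (perm_sort _ _)))/=.
  by rewrite big_map big_enum.
have szks : size ks = n.
  by have := size_char_poly S; rewrite ksE size_prod_XsubC => -[].
have := char_poly_trace S n0.
have := @coefPn_prod_XsubC _ ks.
by rewrite -ksE szks -lt0n => /(_ n0) -> /oppr_inj.
Qed.

Lemma ricci_frame i : (0 < n)%N ->
  ricci f N x (row i E) =
  k 0 i * (\sum_j k 0 j - k 0 i) / (n%:R - 1).
Proof.
move=> n0; rewrite /ricci sqr_enorm /mean_curvature sum_principal_curvatures//.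
rewrite tr_shape_mx [n%:R * _]mulrC divfK ?pnatr_eq0 -?lt0n//.
have -> : shape_op f N x (row i E) = k 0 i *: row i E.
  by rewrite /shape_op -row_mul ES mul_diag_mx; apply/rowP => j; rewrite !mxE.
rewrite /tangent -!scalemxAl -!/(tangent _ _ _) !(dotZl, dotZr) frame_norm.
by congr (_ / _); ring.
Qed.

End PrincipalFrame.

(** * Second derivatives *)

Section Lines.
Context {R : realType} {m : nat}.
Implicit Types (f : 'rV[R]_m -> R) (x y v w : 'rV[R]_m).

Lemma is_derive_line f y v (s : R) :
  differentiable f (y + s *: v) ->
  is_derive s 1 (fun t => f (y + t *: v)) ('D_v f (y + s *: v)).
Proof.
move=> dfs; have : derivable f (y + s *: v) v by exact: diff_derivable.
rewrite /derivable => df.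
have E : (fun h : R => h^-1 *: (f (y + (h *: 1 + s) *: v) - f (y + s *: v))) =
    (fun h : R => h^-1 *: (f (h *: v + (y + s *: v)) - f (y + s *: v))).
  by apply/funext => h; rewrite scalerDl /GRing.scale/= mulr1 addrCA addrA.
by split; rewrite /derivable/derive/= E.
Qed.

Lemma MVT_line f y v (h : R) : 0 < h ->
  (forall s, 0 <= s <= h -> differentiable f (y + s *: v)) ->
  exists2 s, 0 < s < h & f (y + h *: v) - f y = h * 'D_v f (y + s *: v).
Proof.
move=> h0 df.
have [||s sh] := @MVT R (fun t => f (y + t *: v)) (fun t => 'D_v f (y + t *: v)) 0 h h0.
- move=> s; rewrite in_itv/= => /andP[s0 sh]; apply: is_derive_line.
  by apply: df; rewrite !ltW.
- apply: derivable_within_continuous => s; rewrite in_itv/= => sh.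
  have [] // := @is_derive_line f y v s.
  exact: df.
rewrite scale0r addr0 subr0 mulrC => E.
by exists s => //; move: sh; rewrite in_itv.
Qed.

Lemma near_line x v w (A : set 'rV[R]_m) : nbhs x A ->
  exists2 h : R, 0 < h & forall s t, 0 <= s <= h -> 0 <= t <= h -> A (x + s *: v + t *: w).
Proof.
move=> /nbhs_ballP[e /= e0 eA].
have D0 : 0 < `|v| + `|w| + 1 by rewrite ltr_wpDl.
(* The displacement has sup norm at most [h * (|v| + |w|) < e]; the [+ 1] covers [v = w = 0]. *)
exists (e / 2 / (`|v| + `|w| + 1)); first by rewrite !divr_gt0.
set h := _ / (_ + 1) => s t /andP[s0 sh] /andP[t0 th]; apply: eA.
rewrite mx_norm_ball /ball_/= -addrA opprD addrA subrr sub0r normrN.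
apply: le_lt_trans (ler_normD _ _) _; rewrite !normrZ !ger0_norm//.
apply: (@le_lt_trans _ _ (h * (`|v| + `|w| + 1))).
  have h0 : 0 <= h by apply: le_trans sh.
  rewrite !mulrDr mulr1 ler_wpDr// lerD// ler_wpM2r//.
by rewrite /h divfK ?gt_eqF// ltr_pdivrMr// ltr_pMr// ltrDl.
Qed.

(** The mean value theorem twice: along [v] for the increment [g] of [f] by [h *: w], then along [w]
    for the derivative of [f] along [v]. *)
Lemma second_difference f (U : set 'rV[R]_m) x v w (h : R) : 0 < h ->
  (forall s t, 0 <= s <= h -> 0 <= t <= h -> U (x + s *: v + t *: w)) ->
  (forall y, U y -> differentiable f y) ->
  (forall y, U y -> differentiable (fun z => 'D_v f z) y) ->
  exists s t, [/\ 0 < s < h, 0 < t < h &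
    f (x + h *: v + h *: w) - f (x + h *: v) - f (x + h *: w) + f x =
    h * (h * 'D_w (fun z => 'D_v f z) (x + s *: v + t *: w))].
Proof.
move=> h0 hU df ddf; pose g z := f (z + h *: w) - f z.
have hh : 0 <= h <= h by rewrite lexx ltW.
have z0 : 0 <= (0 : R) <= h by rewrite lexx ltW.
have dg s : 0 <= s <= h ->
    is_derive s 1 (fun s => g (x + s *: v))
      ('D_v f (x + s *: v + h *: w) - 'D_v f (x + s *: v)).
  move=> sh; apply: is_deriveB.
    have -> : (fun t => f (x + t *: v + h *: w)) = fun t => f (x + h *: w + t *: v).
      by apply/funext => t; rewrite addrAC.
    rewrite addrAC; apply: is_derive_line; apply: df; rewrite addrAC.
    exact: hU.
  apply: is_derive_line; apply: df.
  by have := hU s 0 sh z0; rewrite scale0r addr0.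
have [||s sh] := @MVT R (fun s => g (x + s *: v)) 
  (fun s => 'D_v f (x + s *: v + h *: w) - 'D_v f (x + s *: v)) 0 h h0.
- move=> s; rewrite in_itv/= => /andP[s0 sh]; apply: dg.
  by rewrite !ltW.
- apply: derivable_within_continuous => s; rewrite in_itv/= => sh.
  by have [] // := dg s sh.
rewrite scale0r addr0 subr0 in_itv/= in sh * => E.
have sh' : 0 <= s <= h by case/andP: sh => ? ?; rewrite !ltW.
have [|t th E2] := @MVT_line (fun z => 'D_v f z) (x + s *: v) w h h0.
  by move=> t th; apply: ddf; apply: hU.
exists s, t; split=> //; rewrite -E2 mulrC -E /g; ring.
Qed.

(** The second difference is symmetric in [v] and [w], so the two mixed derivatives take a common
    value at two points arbitrarily close to [x]; continuity concludes. *)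
Lemma schwarz f (U : set 'rV[R]_m) x v w : open U -> C2_on U f -> U x ->
  'D_w (fun y => 'D_v f y) x = 'D_v (fun y => 'D_w f y) x.
Proof.
move=> oU [[df _] C1] Ux.
have [dv cv] := C1 v; have [dw cw] := C1 w.
apply/eqP; rewrite -subr_eq0 -normr_le0; apply/ler_addgt0Pr => e e0; rewrite add0r.
have e2 : 0 < e / 2 by rewrite divr_gt0.
have n1 : \forall y \near x, `|'D_w (fun y => 'D_v f y) x - 'D_w (fun y => 'D_v f y) y| < e / 2.
  by have /cvgr_dist_lt H := cv w _ Ux; exact: (H _ e2).
have n2 : \forall y \near x, `|'D_v (fun y => 'D_w f y) x - 'D_v (fun y => 'D_w f y) y| < e / 2.
  by clear n1; have /cvgr_dist_lt H := cw v _ Ux; exact: (H _ e2).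
have nU : nbhs x U by exact: open_nbhs_nbhs.
have [h h0 hn] := near_line v w (filterI nU (filterI n1 n2)).
have hU s t : 0 <= s <= h -> 0 <= t <= h -> U (x + s *: v + t *: w).
  by move=> sh th; have [] := hn s t sh th.
have hU' s t : 0 <= s <= h -> 0 <= t <= h -> U (x + s *: w + t *: v).
  by move=> sh th; rewrite addrAC; exact: hU.
have [s [t [/andP[s0 sh] /andP[t0 th] E1]]] := second_difference h0 hU df dv.
have [s' [t' [/andP[s'0 s'h] /andP[t'0 t'h] E2]]] := second_difference h0 hU' df dw.
have [||_ [c1 _]] := hn s t; rewrite ?ltW//.
have [||_ [_ c2]] := hn t' s'; rewrite ?ltW//.
rewrite [x + s' *: w + _]addrAC in E2.
move: E1 E2 c1 c2.
set a := 'D_w _ (x + s *: v + t *: w); set b := 'D_v _ (x + t' *: v + s' *: w).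
set a0 := 'D_w _ x; set b0 := 'D_v _ x.
clearbody a b a0 b0 => E1 E2 c1 c2.
have E : a = b.
  have hn0 : h != 0 by rewrite gt_eqF.
  have : h * (h * a) = h * (h * b).
    by rewrite -E1 -E2 [x + h *: w + _]addrAC; ring.
  by move=> /(mulfI hn0)/(mulfI hn0).
rewrite E in c1.
rewrite (le_lt_trans (ler_distD b a0 b0))// [ltRHS]splitr ltrD//.
by rewrite distrC.
Qed.

End Lines.

(** * Forms with two negative eigenvalues *)

Section TwoNegatives.
Context {R : realType} {n : nat}.

(* For symmetric A: at least two negative eigenvalues, with multiplicity. *)
Definition neg2 (A : 'M[R]_n) :=
  exists C : 'M[R]_(2, n),
    forall z : 'rV_2, z != 0 -> dot (z *m C *m A) (z *m C) < 0.

(** A change of basis carries negative planes to negative planes. Congruence is the relevant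
    relation because principal frames are orthonormal for the metric, not for [dot]. *)
Lemma neg2_congr (E A : 'M[R]_n) : E \in unitmx ->
  neg2 (E *m A *m E^T) <-> neg2 A.
Proof.
have imp F B : neg2 (F *m B *m F^T) -> neg2 B.
  move=> [C Cneg]; exists (C *m F) => z z0; have := Cneg z z0.
  by rewrite !mulmxA dot_mulmxl trmxK -!mulmxA.
move=> Eu; split; first exact: imp.
move=> A2; apply: (imp (invmx E)).
by rewrite !mulmxA mulVmx// mul1mx -mulmxA -trmx_mul mulVmx// trmx1 mulmx1.
Qed.

(** Each error term is at most [e * (y_i^2 + y_j^2) / 2]; the double sum produces the factor [n]. *)
Lemma near_diag_form (B : 'M[R]_n) (d y : 'rV[R]_n) (e : R) :
  (forall i j, `|B i j - diag_mx d i j| <= e) ->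
  `|dot (y *m B) y - \sum_i d 0 i * y 0 i ^+ 2| <= n%:R * e * dot y y.
Proof.
move=> Be.
have -> : dot (y *m B) y - \sum_i d 0 i * y 0 i ^+ 2 =
    \sum_i \sum_j (B i j - diag_mx d i j) * (y 0 i * y 0 j).
  rewrite [in RHS]exchange_big/= /dot -sumrB; apply: eq_bigr => j _.
  rewrite !mxE mulr_suml.
  under [RHS]eq_bigr do rewrite mulrBl.
  rewrite sumrB; congr (_ - _).
    by apply: eq_bigr => i _; ring.
  rewrite (bigD1 j)//= mxE eqxx mulr1n big1 ?addr0; first by ring.
  by move=> i ij; rewrite mxE (negbTE ij) mulr0n mul0r.
apply: (@le_trans _ _ (\sum_i \sum_j e * ((y 0 i ^+ 2 + y 0 j ^+ 2) / 2))).
  apply: le_trans (ler_norm_sum _ _ _) _; apply: ler_sum => i _.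
  apply: le_trans (ler_norm_sum _ _ _) _; apply: ler_sum => j _.
  rewrite normrM ler_pM// normrM -(real_normK (num_real (y 0 i))).
  rewrite -(real_normK (num_real (y 0 j))).
  by have := sqr_ge0 (`|y 0 i| - `|y 0 j|); lra.
rewrite le_eqVlt; apply/orP; left; apply/eqP.
under eq_bigr do rewrite -mulr_sumr -mulr_suml big_split/= sumr_const card_ord.
rewrite -mulr_sumr -mulr_suml big_split/= sumr_const card_ord -sumrMnl.
rewrite (_ : dot y y = \sum_i y 0 i ^+ 2); last by apply: eq_bigr => i _; rewrite expr2.
by rewrite sumrMnl -[_ *+ n]mulr_natl; field.
Qed.

(** The error of the form, at most [n * e * |y|^2], cannot change the sign of a diagonal entry. Two
    negative entries thus span a negative plane; with at most one, every plane contains a nonzero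
    vector on which the form is nonnegative. *)
Lemma neg2_near_diag (B : 'M[R]_n) (d : 'rV[R]_n) (e : R) :
  (forall i, n%:R * e < `|d 0 i|) ->
  (forall i j, `|B i j - diag_mx d i j| <= e) ->
  neg2 B <-> exists i j, [/\ i != j, d 0 i < 0 & d 0 j < 0].
Proof.
move=> de Be; split; last first.
  move=> [i [j [ij di dj]]]; exists (\matrix_(a < 2) delta_mx 0 (if a == 0 then i else j)).
  move=> z z0; set y := z *m _.
  have yE l : y 0 l = z 0 0 *+ (l == i) + z 0 1 *+ (l == j).
    rewrite /y !mxE big_ord_recl big_ord1 !mxE/= !mulr_natr.
    by congr (_ + z 0 _ *+ _); apply: val_inj.
  have yi : y 0 i = z 0 0 by rewrite yE eqxx (negbTE ij) addr0.
  have yj : y 0 j = z 0 1 by rewrite yE eqxx [j == i]eq_sym (negbTE ij) add0r.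
  have y0 : y != 0.
    apply: contraNneq z0 => y0; apply/eqP/rowP => a; rewrite mxE.
    have z00 : z 0 0 = 0 by rewrite -yi y0 mxE.
    have z01 : z 0 1 = 0 by rewrite -yj y0 mxE.
    case: a => [[|[|//]] la]; first by rewrite -[RHS]z00; congr (z _ _); apply: val_inj.
    by rewrite -[RHS]z01; congr (z _ _); apply: val_inj.
  (* [y] is supported on [i] and [j], where [d + n * e] is still negative. *)
  have : \sum_l (d 0 l + n%:R * e) * y 0 l ^+ 2 < 0.
    rewrite ltNge; apply/negP => H.
    have neg l : (d 0 l + n%:R * e) * y 0 l ^+ 2 <= 0.
      rewrite yE; have := de i; have := de j; rewrite !ltr0_norm//.
      have [->|li] := eqVneq l i; first by move=> _ h; rewrite mulr_le0_ge0 ?sqr_ge0//; lra.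
      have [->|lj] := eqVneq l j; first by move=> h _; rewrite mulr_le0_ge0 ?sqr_ge0//; lra.
      by rewrite addr0 expr0n mulr0.
    case/negP: y0; apply/eqP/rowP => l; rewrite [RHS]mxE.
    have : \sum_l (- ((d 0 l + n%:R * e) * y 0 l ^+ 2)) == 0.
      rewrite eq_le sumr_ge0 ?andbT; last by move=> k _; rewrite oppr_ge0.
      by rewrite sumrN oppr_le0.
    rewrite psumr_eq0; last by move=> k _; rewrite oppr_ge0.
    move=> /allP/(_ l (mem_index_enum _)); rewrite /= oppr_eq0 mulf_eq0 sqrf_eq0.
    case/orP => [|/eqP//].
    rewrite yE; have [->|li] := eqVneq l i.
      by have := de i; rewrite ltr0_norm// => ? /eqP; lra.
    have [->|lj] := eqVneq l j; last by rewrite addr0.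
    by have := de j; rewrite ltr0_norm// => ? /eqP; lra.
  have := near_diag_form y Be; rewrite ler_norml => /andP[_].
  rewrite lerBlDr => /le_lt_trans H S; apply: H.
  move: S; under eq_bigr do rewrite mulrDl.
  rewrite big_split/= -mulr_sumr addrC.
  by rewrite (_ : dot y y = \sum_i y 0 i ^+ 2)//; apply: eq_bigr => l _; rewrite expr2.
move=> [C Cneg]; apply: contrapT => no2.
(* [j] is the only index whose entry may be negative, or [None]. *)
have [j dj] : exists j : option 'I_n, forall i, Some i != j -> 0 < d 0 i.
  have nz i : d 0 i != 0.
    apply/eqP => di; have := de i; rewrite di normr0.
    by have := le_trans (normr_ge0 _) (Be i i); rewrite ltNge => e0; rewrite mulr_ge0.
  have [[j dj]|noneg] := pselect (exists j, d 0 j < 0).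
    exists (Some j) => i ij; rewrite lt_neqAle eq_sym nz leNgt/=; apply/negP => di.
    by apply: no2; exists i, j.
  exists None => i _; rewrite lt_neqAle eq_sym nz leNgt/=; apply/negP => di.
  by apply: noneg; exists i.
(* The plane meets the hyperplane where coordinate [j] vanishes: a column of height two has a
   nonzero left kernel. *)
have [z z0 zj] : exists2 z : 'rV[R]_2, z != 0 & forall l, Some l = j -> (z *m C) 0 l = 0.
  case: j dj => [j|] dj; last first.
    by exists (const_mx 1) => //; apply/eqP => /rowP/(_ 0)/eqP; rewrite !mxE oner_eq0.
  have : \rank (kermx (col j C)) != 0%N.
    rewrite mxrank_ker subn_eq0 -ltnNge.
    exact: leq_ltn_trans (rank_leq_col _) _.
  rewrite mxrank_eq0 => /rowV0Pn[z /sub_kermxP zC z0].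
  exists z => // _ [->]; have /matrixP/(_ 0 0) := zC; rewrite !mxE => zj.
  by rewrite -[RHS]zj; apply: eq_bigr => k _; rewrite !mxE.
have := Cneg z z0; set y := z *m C in zj *; apply/negP; rewrite -leNgt.
have := near_diag_form y Be; rewrite ler_norml => /andP[+ _].
rewrite lerBrDr; apply: le_trans.
rewrite (_ : dot y y = \sum_i y 0 i ^+ 2); last by apply: eq_bigr => l _; rewrite expr2.
rewrite -mulrN -sumrN mulr_sumr -big_split/=; apply: sumr_ge0 => l _.
have [lj|lj] := eqVneq (Some l) j; first by rewrite zj// expr0n/= oppr0 !mulr0 addr0.
rewrite mulrN addrC -mulrBl mulr_ge0 ?sqr_ge0// subr_ge0.
by have := de l; rewrite gtr0_norm ?dj// => /ltW.
Qed.

End TwoNegatives.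

Lemma dot_row_mx {R : realType} {m p} (a c : 'rV[R]_m) (b d : 'rV[R]_p) :
  dot (row_mx a b) (row_mx c d) = dot a c + dot b d.
Proof. by rewrite !dotE tr_row_mx mul_row_col mxE. Qed.

Lemma dot_scalar {R : realType} (a b : R) : dot (a%:M : 'rV_1) b%:M = a * b.
Proof. by rewrite /dot big_ord1 !mxE. Qed.

(** * Gradient, Hessian and tangent vectors of a graph *)

Section Derivatives.
Context {R : realType} {m : nat}.
Implicit Types (f g : 'rV[R]_m -> R) (x y v w : 'rV[R]_m).

Lemma differentiable_rV {p} (M : 'rV[R]_m -> 'rV[R]_p) x :
  (forall j, differentiable (fun y => M y 0 j) x) -> differentiable M x.
Proof.
move=> dM.
rewrite (_ : M = \sum_j (fun y => M y 0 j *: delta_mx 0 j)); last first.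
  by apply/funext => y; rewrite fct_sumE -row_sum_delta.
by apply: differentiable_sum => j; exact: differentiableZl.
Qed.

Lemma differentiable_entry {p} (M : 'rV[R]_m -> 'rV[R]_p) x j :
  differentiable M x -> differentiable (fun y => M y 0 j) x.
Proof.
move=> dM; apply: (@differentiable_comp _ _ _ _ M (fun A : 'rV[R]_p => A 0 j)) => //.
exact: differentiable_coord.
Qed.

Lemma derive_dot {p} (a b : 'rV[R]_m -> 'rV[R]_p) x v :
  differentiable a x -> differentiable b x ->
  'D_v (fun y => dot (a y) (b y)) x = dot ('D_v a x) (b x) + dot (a x) ('D_v b x).
Proof.
move=> da db.
have dva : derivable a x v by exact: diff_derivable.
have dvb : derivable b x v by exact: diff_derivable.
rewrite (derive_mx dva) (derive_mx dvb).
rewrite (_ : (fun y => _) = \sum_i (fun y => a y 0 i * b y 0 i)); last first.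
  by apply/funext => y; rewrite fct_sumE.
have dai i : derivable (fun y => a y 0 i) x v by have /derivable_mxP := dva; exact.
have dbi i : derivable (fun y => b y 0 i) x v by have /derivable_mxP := dvb; exact.
rewrite derive_sum => [|i]; last exact: derivableM.
rewrite /dot -big_split/=; apply: eq_bigr => i _.
by rewrite deriveM// !mxE /GRing.scale/=; ring.
Qed.

Definition grad f y : 'rV[R]_m := \row_i 'D_(delta_mx 0 i) f y.

(** With this order of differentiation, [v *m hess f y] is the derivative of the gradient along [v]
    before any symmetry is known. *)
Definition hess f y : 'M[R]_m :=
  \matrix_(i, j) 'D_(delta_mx 0 i) (fun z => 'D_(delta_mx 0 j) f z) y.

Lemma derive_grad f y v : differentiable f y -> 'D_v f y = dot (grad f y) v.
Proof.
move=> df; rewrite deriveE// {1}(row_sum_delta v) linear_sum/=.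
by apply: eq_bigr => i _; rewrite linearZ/= mxE deriveE// mulrC.
Qed.

Lemma derive_gradC f y v : differentiable f y -> 'D_v f y = dot v (grad f y).
Proof. by move=> df; rewrite derive_grad// dotC. Qed.

Section C2.
Variables (U : set 'rV[R]_m) (f : 'rV[R]_m -> R).
Hypotheses (oU : open U) (C2 : C2_on U f).

Let df y : U y -> differentiable f y.
Proof. by case: C2 => -[df _] _; exact: df. Qed.

Let ddf v y : U y -> differentiable (fun z => 'D_v f z) y.
Proof. by case: C2 => _ /(_ v)[ddf _]; exact: ddf. Qed.

Lemma differentiable_grad y : U y -> differentiable (grad f) y.
Proof.
move=> Uy; apply: differentiable_rV => j.
rewrite (_ : (fun _ => _) = fun z => 'D_(delta_mx 0 j) f z); first exact: ddf.
by apply/funext => z; rewrite mxE.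
Qed.

Lemma derive_grad_hess y v : U y -> 'D_v (grad f) y = v *m hess f y.
Proof.
move=> Uy; have dg := differentiable_grad Uy.
have dgv : derivable (grad f) y v by exact: diff_derivable.
rewrite (derive_mx dgv); apply/rowP => j; rewrite !mxE.
rewrite (_ : (fun _ => _) = fun z => 'D_(delta_mx 0 j) f z); last first.
  by apply/funext => z; rewrite mxE.
rewrite derive_gradC; last exact: ddf.
by apply: eq_bigr => i _; rewrite !mxE.
Qed.

Lemma derive2_hess y v w : U y ->
  'D_v (fun z => 'D_w f z) y = dot (v *m hess f y) w.
Proof.
move=> Uy; rewrite (@near_eq_derive _ _ _ _ (fun z => dot (grad f z) w)); last first.
  have : nbhs y U by exact: open_nbhs_nbhs.
  by apply: filterS => z Uz; rewrite derive_grad//; exact: df.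
rewrite derive_dot//; last exact: differentiable_grad.
rewrite derive_grad_hess// (_ : 'D_v (fun=> w) y = 0) ?dotE; last exact: derive_cst.
by rewrite trmx0 mulmx0 [X in _ + X]mxE addr0.
Qed.

Lemma hess_sym y : U y -> (hess f y)^T = hess f y.
Proof. by move=> Uy; apply/matrixP => i j; rewrite !mxE (schwarz _ _ oU C2). Qed.

Lemma continuous_hess y : U y -> {for y, continuous (hess f)}.
Proof.
move=> Uy; apply: continuous_mx => i j.
rewrite (_ : (fun _ => _) = fun z => 'D_(delta_mx 0 i) (fun z => 'D_(delta_mx 0 j) f z) z).
  by case: C2 => _ /(_ (delta_mx 0 j))[_]; exact.
by apply/funext => z; rewrite mxE.
Qed.

Lemma differentiable_graph_map y : U y -> differentiable (graph_map f) y.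
Proof.
move=> Uy; apply: differentiable_rV => j.
case: (splitP j) => l jl.
  rewrite (_ : (fun _ => _) = fun z : 'rV[R]_m => z 0 l); first exact: differentiable_coord.
  apply/funext => z; rewrite (_ : j = lshift 1 l); last exact: val_inj.
  by rewrite row_mxEl.
rewrite (_ : (fun _ => _) = f); first exact: df.
apply/funext => z; rewrite (_ : j = rshift m l); last exact: val_inj.
by rewrite row_mxEr !mxE !ord1 eqxx.
Qed.

Lemma tangentE y v : U y -> tangent f y v = row_mx v ('D_v f y)%:M.
Proof.
move=> Uy; have dg := differentiable_graph_map Uy.
rewrite /tangent -deriveEjacobian//.
have dgv : derivable (graph_map f) y v by exact: diff_derivable.
rewrite (derive_mx dgv); apply/rowP => j; rewrite mxE.
case: (splitP j) => l jl.
  rewrite (_ : j = lshift 1 l); last exact: val_inj.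
  rewrite row_mxEl (_ : (fun _ => _) = fun z : 'rV[R]_m => z 0 l); last first.
    by apply/funext => z; rewrite row_mxEl.
  have := @derive_mx _ _ _ _ id y v (@derivable_id _ _ y v).
  by rewrite derive_id => /rowP/(_ l); rewrite mxE.
rewrite (_ : j = rshift m l); last exact: val_inj.
rewrite row_mxEr (_ : (fun _ => _) = f); last first.
  by apply/funext => z; rewrite row_mxEr !mxE !ord1 eqxx.
by rewrite mxE ord1 eqxx.
Qed.

End C2.
End Derivatives.

(** * The unit normal of a graph *)

(** Differentiability depends only on the germ at [x]: the differential of [g] serves for [f], with
    the same remainder near [x]. *)
Lemma near_eq_differentiable {R : numFieldType} {V W : normedModType R}
    (f g : V -> W) x :
  (\near x, f x = g x) -> differentiable g x -> differentiable f x.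
Proof.
move=> fg dg; have fx : f x = g x by exact: nbhs_singleton fg.
apply/diffP => /=.
apply: (@getPex _ (fun (df : {linear V -> W}) => continuous df /\
  forall y, f y = f (lim (nbhs x)) + df (y - lim (nbhs x))
                  +o_(y \near x) (y - lim (nbhs x)))).
exists ('d g x); split; first exact: diff_continuous.
have [[_ Eg]] := dg; have Hg := iffLR (eqaddoP _ _ _ _) Eg.
pose G y := f (lim (nbhs x)) + 'd g x (y - lim (nbhs x)).
suff H0 : forall e : R, 0 < e ->
    \forall y \near x, `|(f - G) y| <= e * `|y - lim (nbhs x)|.
  have H := iffRL (eqaddoP (nbhs x) f G (fun y => y - lim (nbhs x))) H0.
  by move=> y; have := congr1 (@^~ y) H; rewrite /= !fctE.
move=> e e0; apply: filterS2 fg (Hg e e0) => y fgy.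
by rewrite !fctE /G/= fgy !lim_id// fx.
Qed.
Section UnitNormal.
Context {R : realType} {n : nat}.
Variables (U : set 'rV[R]_n) (f : 'rV[R]_n -> R) (N : 'rV[R]_n -> 'rV[R]_(n + 1)).
Hypotheses (oU : open U) (C2 : C2_on U f) (hN : unit_normal_field U f N).

Let df y : U y -> differentiable f y.
Proof. by case: C2 => -[df _] _; exact: df. Qed.

Let eta y := N y 0 (rshift n 0).

(** The squared length of the upward normal [(- grad f, 1)]. *)
Definition slope y := 1 + dot (grad f y) (grad f y).

Lemma slope_gt0 y : 0 < slope y.
Proof. by rewrite ltr_wpDr ?dot_ge0. Qed.

(** Orthogonality to the tangent vector [(e_i, D_i f)] determines the i-th horizontal component from
    the vertical one, [eta]. *)
Lemma normalE y : U y -> N y = eta y *: row_mx (- grad f y) 1%:M.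
Proof.
move=> Uy; have [_ _ orth] := hN Uy.
have NE : N y = row_mx (lsubmx (N y)) (eta y)%:M.
  rewrite -[LHS]hsubmxK; congr row_mx; apply/rowP => j.
  by rewrite !ord1 !mxE eqxx.
rewrite scale_row_mx scale_scalar_mx mulr1 {1}NE; congr row_mx.
apply/rowP => i; have := orth (delta_mx 0 i).
rewrite NE (tangentE C2)// dot_row_mx dot_scalar dot_delta -NE.
by rewrite !mxE => /eqP; rewrite addr_eq0 => /eqP ->; rewrite mulrN.
Qed.

Lemma sqr_eta y : U y -> eta y ^+ 2 * slope y = 1.
Proof.
move=> Uy; have [_ N1 _] := hN Uy.
have : dot (N y) (N y) = 1 by rewrite -sqr_enorm N1 expr1n.
rewrite [in dot _ _](normalE Uy) dotZl dotZr dot_row_mx dotNl dotNr opprK.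
by rewrite dot_scalar mulr1 mulrA -expr2 [dot _ _ + 1]addrC.
Qed.

Lemma norm_eta y : U y -> `|eta y| = (Num.sqrt (slope y))^-1.
Proof.
move=> Uy; have s0 := slope_gt0 y; rewrite -sqrtr_sqr -sqrtrV ?ltW//.
congr Num.sqrt; apply: (mulIf (lt0r_neq0 s0)).
by rewrite sqr_eta// mulVf// lt0r_neq0.
Qed.

Lemma eta_neq0 y : U y -> eta y != 0.
Proof. by move=> Uy; rewrite -normr_gt0 norm_eta// invr_gt0 sqrtr_gt0 slope_gt0. Qed.

Lemma differentiable_slope y : U y -> differentiable slope y.
Proof.
move=> Uy; apply: differentiableD; first exact: differentiable_cst.
rewrite (_ : (fun _ => _) = \sum_i (fun y => grad f y 0 i * grad f y 0 i)); last first.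
  by apply/funext => z; rewrite fct_sumE.
apply: differentiable_sum => i; apply: differentiableM; apply: differentiable_entry;
  exact: (differentiable_grad C2).
Qed.

(** [N] is only assumed continuous, but [eta] never vanishes, so its sign is locally constant and
    [eta] is locally a constant multiple of the differentiable function [1 / sqrt slope]. *)
Lemma differentiable_eta y : U y -> differentiable eta y.
Proof.
move=> Uy; have [cN _ _] := hN Uy.
apply: (@near_eq_differentiable _ _ _ _ (fun z => Num.sg (eta y) * (Num.sqrt (slope z))^-1)).
  have ce : {for y, continuous eta}.
    apply: (@continuous_comp _ _ _ N (fun M : 'rV[R]_(n + 1) => M 0 (rshift n 0))) => //.
    exact: coord_continuous.
  have nU : nbhs y U by exact: open_nbhs_nbhs.
  have : \forall z \near y, Num.sg (eta z) = Num.sg (eta y).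
    have := eta_neq0 Uy; rewrite neq_lt => /orP[e0|e0].
      have : \forall z \near y, eta z < 0 by have /cvgr_lt := ce; exact.
      by apply: filterS => z z0; rewrite !ltr0_sg.
    have : \forall z \near y, 0 < eta z by have /cvgr_gt := ce; exact.
    by apply: filterS => z z0; rewrite !gtr0_sg.
  apply: filterS2 nU => z Uz sz.
  by rewrite -sz -norm_eta// -numEsg.
apply: differentiableM; first exact: differentiable_cst.
apply: differentiableV; last by rewrite lt0r_neq0// sqrtr_gt0 slope_gt0.
apply: (@differentiable_comp _ _ _ _ slope Num.sqrt).
  exact: differentiable_slope.
apply/derivable1_diffP.
by have [] := is_derive1_sqrt (slope_gt0 y).
Qed.

Lemma differentiable_normal y : U y -> differentiable N y.
Proof.
move=> Uy; have nU : nbhs y U by exact: open_nbhs_nbhs.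
apply: (@near_eq_differentiable _ _ _ _ (fun z => eta z *: row_mx (- grad f z) 1%:M)).
  by apply: filterS nU => z Uz; exact: normalE.
apply: differentiable_rV => j.
rewrite (_ : (fun _ => _) =
    fun z => eta z * (row_mx (- grad f z) 1%:M : 'rV_(n + 1)) 0 j); last first.
  by apply/funext => z; rewrite mxE.
apply: differentiableM; first exact: differentiable_eta.
case: (splitP j) => l jl.
  rewrite (_ : (fun _ => _) = fun z => - (grad f z 0 l)); last first.
    by apply/funext => z; rewrite (_ : j = lshift 1 l) ?row_mxEl ?mxE//; exact: val_inj.
  apply: differentiableN; apply: differentiable_entry; exact: (differentiable_grad C2).
rewrite (_ : (fun _ => _) = cst 1); first exact: differentiable_cst.
apply/funext => z; rewrite (_ : j = rshift n l) ?row_mxEr; last exact: val_inj.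
by rewrite !mxE ord1 eqxx.
Qed.

Lemma derive_normal_normal y v : U y -> dot ('D_v N y) (N y) = 0.
Proof.
move=> Uy; have nU : nbhs y U by exact: open_nbhs_nbhs.
have dN := differentiable_normal Uy.
have : 'D_v (fun z => dot (N z) (N z)) y = 0.
  rewrite (@near_eq_derive _ _ _ _ (fun=> 1 : R)); first exact: derive_cst.
  by apply: filterS nU => z Uz; have [_ N1 _] := hN Uz; rewrite -sqr_enorm N1 expr1n.
by rewrite derive_dot// [X in _ + X]dotC => /eqP; rewrite -mulr2n mulrn_eq0/= => /eqP.
Qed.

(** Differentiate the orthogonality of [N] to the tangent field [T] with constant horizontal part
    [w]: the derivative of [T] is vertical and equals the second derivative of [f]. *)
Lemma derive_normal_tangent y v w : U y ->
  dot ('D_v N y) (tangent f y w) = - eta y * dot (v *m hess f y) w.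
Proof.
move=> Uy; have nU : nbhs y U by exact: open_nbhs_nbhs.
have dN := differentiable_normal Uy.
pose T z : 'rV[R]_(n + 1) := row_mx w ('D_w f z)%:M.
have TE z j : T z 0 j = row_mx w 0 0 j + 'D_w f z * row_mx 0 1%:M 0 j.
  rewrite /T; case: (splitP j) => l jl.
    by rewrite (_ : j = lshift 1 l) ?row_mxEl ?mxE ?mulr0 ?addr0//; exact: val_inj.
  rewrite (_ : j = rshift n l) ?row_mxEr; last exact: val_inj.
  by rewrite !mxE ord1 eqxx mulr1 add0r.
have ddf : differentiable (fun z => 'D_w f z) y.
  by case: C2 => _ /(_ w)[d _]; exact: d.
have dT : differentiable T y.
  apply: differentiable_rV => j; under eq_fun do rewrite TE.
  apply: differentiableD; first exact: differentiable_cst.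
  by apply: differentiableM => //; exact: differentiable_cst.
have DT : 'D_v T y = row_mx 0 (dot (v *m hess f y) w)%:M.
  have dTv : derivable T y v by exact: diff_derivable.
  rewrite (derive_mx dTv) -(derive2_hess oU C2)//; apply/rowP => j; rewrite mxE.
  case: (splitP j) => l jl.
    rewrite (_ : j = lshift 1 l) ?row_mxEl; last exact: val_inj.
    rewrite (_ : (fun _ => _) = cst (w 0 l)) ?derive_cst ?mxE//.
    by apply/funext => z; rewrite row_mxEl.
  rewrite (_ : j = rshift n l) ?row_mxEr; last exact: val_inj.
  rewrite (_ : (fun _ => _) = 'D_w f); first by rewrite mxE [l]ord1 eqxx.
  by apply/funext => z; rewrite row_mxEr mxE !ord1 eqxx.
have : 'D_v (fun z => dot (N z) (T z)) y = 0.
  rewrite (@near_eq_derive _ _ _ _ (fun=> 0 : R)); first exact: derive_cst.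
  apply: filterS nU => z Uz; have [_ _ orth] := hN Uz.
  by have := orth w; rewrite (tangentE C2).
rewrite derive_dot// (tangentE C2)// -/(T y) => /eqP; rewrite addr_eq0 => /eqP ->.
rewrite DT {1}(normalE Uy) dotZl dot_row_mx dot_scalar mul1r mulNr.
by rewrite [dot _ 0]dotC dotE mul0mx mxE add0r.
Qed.

(** The second fundamental form is [eta] times the Hessian. *)
Lemma shape_mx_hess y : U y ->
  shape_mx f N y *m metric_mx f y = eta y *: hess f y.
Proof.
move=> Uy; have dN := differentiable_normal Uy.
have e0 := eta_neq0 Uy.
(* The derivatives of [N] are orthogonal to [N], hence tangent, so that [pinvmx] returns true
   coordinates. *)
have sub : (- 'J N y <= 'J (graph_map f) y)%MS.
  apply/row_subP => i; set u := row i _.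
  have uN : dot u (N y) = 0.
    by rewrite /u linearN/= rowE -deriveEjacobian// dotNl derive_normal_normal// oppr0.
  suff -> : u = tangent f y (lsubmx u) by exact: submxMl.
  rewrite (tangentE C2)// -[LHS]hsubmxK; congr row_mx.
  move: uN; rewrite normalE// dotZr -{1}[u]hsubmxK dot_row_mx dotNr => /eqP.
  rewrite mulf_eq0 (negbTE e0)/= addrC subr_eq0 => /eqP E.
  rewrite (derive_gradC _ (df Uy)) -E; apply/rowP => j.
  by rewrite !ord1 /dot big_ord1 !mxE eqxx mulr1.
rewrite /metric_mx mulmxA /shape_mx mulmxKpV//.
apply/row_matrixP => i; apply/rowP => j.
rewrite -[LHS]dot_delta -[RHS]dot_delta row_mul linearN/= mulNmx dotNl.
rewrite dot_mulmxl trmxK.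
have := derive_normal_tangent (delta_mx 0 i) (delta_mx 0 j) Uy.
rewrite deriveEjacobian// -rowE /tangent => ->.
by rewrite mulNr opprK linearZ/= dotZl -rowE.
Qed.

End UnitNormal.

(** * Contact with a hemisphere *)

(** If [D < 0], then [h1] is negative just to the right of [0], and the mean value theorem
    contradicts minimality. *)
Lemma second_derivative_test {R : realType} (h h1 : R -> R) (D e : R) : 0 < e ->
  (forall t : R, `|t| < e -> is_derive t 1 h (h1 t)) -> is_derive (0 : R) 1 h1 D ->
  (forall t : R, `|t| < e -> h 0 <= h t) -> h1 0 = 0 /\ 0 <= D.
Proof.
move=> e0 dh dh1 hmin.
have inI t : (t \in `]-e, e[) = (`|t| < e) by rewrite in_itv/= -ltr_norml.
have h10 : h1 0 = 0.
  have dh0 : is_derive (0 : R) 1 h (h1 0) by apply: dh; rewrite normr0.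
  have : is_derive (0 : R) 1 h 0.
    apply: (@derive1_at_min _ h (- e) e 0).
    - by rewrite ge0_cp// ltW.
    - by move=> t; rewrite inI => /dh[].
    - by rewrite inI normr0.
    - by move=> t; rewrite inI => /hmin.
  by have [_ <-] := dh0; move=> [_ ->].
split => //; rewrite leNgt; apply/negP => D0.
have [dv DE] := dh1.
have : (fun t => t^-1 *: (h1 (t *: 1 + 0) - h1 0)) @ 0^' --> D.
  by rewrite -DE; exact: dv.
move=> /cvgr_lt/(_ _ D0).
move=> /nbhs_ballP[d /= d0 dP].
pose t := Num.min d e / 2.
have m0 : 0 < Num.min d e by rewrite lt_min d0.
have t0 : 0 < t by rewrite divr_gt0.
have : t < Num.min d e by rewrite ltr_pdivrMr// ltr_pMr// ltrDl.
rewrite lt_min => /andP[td te].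
have neg s : 0 < s -> s < d -> h1 s < 0.
  move=> s0 sd.
  have : s^-1 *: (h1 (s *: 1 + 0) - h1 0) < 0.
    apply: dP; last by rewrite gt_eqF.
    by rewrite /ball/= sub0r normrN gtr0_norm.
  by rewrite h10 subr0 addr0 /GRing.scale/= mulr1 pmulr_rlt0// invr_gt0.
have [||s] := @MVT R h h1 0 t t0.
- move=> s; rewrite in_itv/= => /andP[s0 st]; apply: dh.
  by rewrite gtr0_norm// (lt_trans st).
- apply: derivable_within_continuous => s; rewrite in_itv/= => /andP[s0 st].
  have [] // := dh s.
  by rewrite ger0_norm// (le_lt_trans st).
rewrite in_itv/= subr0 => /andP[s0 st] E.
have := hmin t; rewrite gtr0_norm// => /(_ te); rewrite -subr_ge0 E leNgt => /negP; apply.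
by rewrite pmulr_llt0// neg// (lt_trans st).
Qed.

Section Hemisphere.
Context {R : realType} {n : nat}.
Variables (U : set 'rV[R]_n) (f : 'rV[R]_n -> R) (c : 'rV[R]_n) (r : R).
Hypotheses (oU : open U) (C2 : C2_on U f) (r0 : 0 < r) (BU : closed_eball c r `<=` U).

Let df y : U y -> differentiable f y.
Proof. by case: C2 => -[df _] _; exact: df. Qed.

Let r0' : 0 <= r := ltW r0.

(** How far the lower hemisphere of radius [r] hangs below its centre over the point [y]. *)
Let depth y := Num.sqrt (r ^+ 2 - dot (y - c) (y - c)).

Lemma continuous_depth : continuous depth.
Proof.
move=> y; apply: continuous_comp; last exact: sqrt_continuous.
have cB : {for y, continuous (fun y : 'rV[R]_n => y - c)}.
  by apply: continuousB => //; exact: cst_continuous.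
by apply: continuousB; [exact: cst_continuous | exact: (continuous_dot cB cB)].
Qed.

(** The maximum of [f + depth] is the lowest height of the centre that keeps the hemisphere above
    the graph; a maximiser is a contact point. *)
Lemma hemisphere_contact : exists2 x0, closed_eball c r x0 &
  forall y, closed_eball c r y -> f y + depth y <= f x0 + depth x0.
Proof.
have [||x0] := @compact_EVT_max _ _ (fun y => f y + depth y) _ _
    (@closed_eball_compact _ _ c r).
- by exists c; rewrite /closed_eball/= subrr /enorm dotE mul0mx mxE sqrtr0 ltW.
- apply: continuous_in_subspaceT => y; rewrite inE => yB; apply: continuousD.
    by apply: differentiable_continuous; apply: df; exact: BU.
  exact: continuous_depth.
rewrite inE => x0B x0max; exists x0 => // y yB; apply: x0max.
by rewrite inE.
Qed.

(* The hemisphere is vertical along its boundary while f is differentiable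
   there, so the contact point is interior. *)
Lemma hemisphere_contact_interior x0 : closed_eball c r x0 ->
  (forall y, closed_eball c r y -> f y + depth y <= f x0 + depth x0) ->
  dot (x0 - c) (x0 - c) < r ^+ 2.
Proof.
rewrite /closed_eball/= enorm_le// => x0B x0max.
rewrite lt_neqAle x0B andbT; apply/negP => /eqP x0r.
have Ux0 : U x0 by apply: BU; rewrite /closed_eball/= enorm_le// x0r.
pose D := 'D_(c - x0) f x0.
have dv : (fun t : R => t^-1 *: (f (t *: (c - x0) + x0) - f x0)) @ 0^' --> D.
  by have : derivable f x0 (c - x0) by [exact/diff_derivable/df]; exact.
have /cvgr_gt/(_ (D - 1)) := dv.
rewrite ltrBlDr ltrDl => /(_ ltr01) /nbhs_ballP[d /= d0 dP].
(* Moving by [t *: (c - x0)] lowers [f] by at most [L * t]. *)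
pose L := `|D| + 1; have L0 : 0 < L by rewrite ltr_wpDl.
have m0 : 0 < Num.min (Num.min d 1) (r / L) by rewrite !lt_min d0 ltr01 divr_gt0.
have [s s0 sm] : exists2 s, 0 < s & s < Num.min (Num.min d 1) (r / L).
  exists (Num.min (Num.min d 1) (r / L) / 2); first by rewrite divr_gt0.
  by rewrite ltr_pdivrMr// ltr_pMr// ltrDl.
have := sm; rewrite !lt_min => /andP[/andP[sd s1] sL].
(* The depth gained is at least [r * s], of order [sqrt t]; it exceeds the loss [L * s^2] because
   [s < r / L]. *)
pose t := s ^+ 2.
have t0 : 0 < t by rewrite exprn_gt0.
have ts : t < s by rewrite /t expr2 -[ltRHS]mulr1 ltr_pM2l.
have t1 : t < 1 by exact: lt_trans s1.
have yc : t *: (c - x0) + x0 - c = (1 - t) *: (x0 - c).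
  by apply/rowP => i; rewrite !mxE; ring.
have rt : r ^+ 2 * t <= r ^+ 2 - (1 - t) * ((1 - t) * r ^+ 2).
  have : 0 < r ^+ 2 by rewrite exprn_gt0.
  by move: t0 t1; nra.
have yB : closed_eball c r (t *: (c - x0) + x0).
  rewrite /closed_eball/= enorm_le// yc dotZl dotZr x0r -subr_ge0.
  by apply: le_trans rt; rewrite mulr_ge0 ?ltW// exprn_gt0.
have := x0max _ yB; rewrite /depth yc dotZl dotZr x0r subrr sqrtr0 addr0.
have : r * s <= Num.sqrt (r ^+ 2 - (1 - t) * ((1 - t) * r ^+ 2)).
  rewrite -[leLHS]ger0_norm; last by rewrite mulr_ge0// ltW.
  by rewrite -sqrtr_sqr ler_wsqrtr// exprMn.
have := dP t; rewrite /ball/= sub0r normrN gtr0_norm// => /(_ (lt_trans ts sd)).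
rewrite gt_eqF// => /(_ isT); rewrite /GRing.scale/= ltr_pdivlMl//.
set fy := f _; set q := Num.sqrt _ => A1 A2 A3.
have : r * s <= L * t.
  have : - `|D| <= D by rewrite lerNnormlW.
  have : r * s <= - (t * (D - 1)) by lra.
  rewrite /L => + A4; nra.
rewrite /t expr2 mulrA ler_pM2r// -ler_pdivrMl// mulrC leNgt.
by rewrite sL.
Qed.

(** At a contact point the squared distance from the graph to the centre [(c, z)] of the sphere is
    minimal. The second-order condition says that the upward second fundamental form is at most
    [1/r] times the metric. *)
Lemma hemisphere_touching : exists2 x0, closed_eball c r x0 &
  forall u, dot (u *m hess f x0) u <=
    Num.sqrt (slope f x0) / r * (dot u u + dot u (grad f x0) ^+ 2).
Proof.
have [x0 x0B x0max] := hemisphere_contact.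
have x0i := hemisphere_contact_interior x0B x0max.
exists x0 => //.
have Ux0 : U x0 by exact: BU.
pose z := f x0 + depth x0; pose s := depth x0.
have [a aD] : exists a, a = x0 - c by eexists.
have s0 : 0 < s by rewrite sqrtr_gt0 subr_gt0.
have sE : s ^+ 2 = r ^+ 2 - dot a a by rewrite aD sqr_sqrtr// subr_ge0 ltW.
have nB : nbhs x0 (closed_eball c r).
  have ca : {for x0, continuous (fun y : 'rV[R]_n => dot (y - c) (y - c))}.
    have cB : {for x0, continuous (fun y : 'rV[R]_n => y - c)}.
      by apply: continuousB => //; exact: cst_continuous.
    exact: (continuous_dot cB cB).
  have : \forall y \near x0, dot (y - c) (y - c) < r ^+ 2.
    by have /cvgr_lt := ca; exact.
  by apply: filterS => y yr; rewrite /closed_eball/= enorm_le// ltW.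
(* Both conditions, halved, for the squared distance [h] along [x0 + t *: u]; [h1] is its
   derivative. *)
have key u : dot a u + (f x0 - z) * 'D_u f x0 = 0 /\
    0 <= dot u u + 'D_u f x0 ^+ 2 + (f x0 - z) * 'D_u (fun y => 'D_u f y) x0.
  pose h t := dot a a + 2 * t * dot a u + t ^+ 2 * dot u u + (f (x0 + t *: u) - z) ^+ 2.
  pose h1 t := 2 * dot a u + 2 * t * dot u u + 2 * (f (x0 + t *: u) - z) * 'D_u f (x0 + t *: u).
  have hE t : h t = dot (x0 + t *: u - c) (x0 + t *: u - c) + (f (x0 + t *: u) - z) ^+ 2.
    have -> : x0 + t *: u - c = a + t *: u by rewrite aD addrAC.
    rewrite /h !(dotDl, dotDr, dotZl, dotZr) (dotC u a); ring.
  (* Parameters in [near_line] are nonnegative, so [u] and [- u] are treated separately. *)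
  have [e e0 eB] := near_line u 0 nB.
  have [e' e'0 eB'] := near_line (- u) 0 nB.
  pose d := Num.min e e'.
  have inB (t : R) : `|t| < d -> closed_eball c r (x0 + t *: u).
    rewrite lt_min => /andP[te te'].
    have [t0|t0] := leP 0 t.
      have := eB t 0; rewrite scaler0 addr0 => E.
      by apply: E; rewrite ?t0 ?lexx/= ltW// -(ger0_norm t0).
    have := eB' (- t) 0; rewrite scaler0 addr0 scalerN scaleNr opprK => E.
    apply: E; last by rewrite lexx ltW.
    by rewrite oppr_ge0 (ltW t0)/= ltW// -(ltr0_norm t0).
  have dh (t : R) : `|t| < d -> is_derive t 1 h (h1 t).
    move=> /inB/BU Ut; have dl := @is_derive_line _ _ f x0 u t (df Ut).
    apply: is_derive_eq.
    rewrite /h1 /GRing.scale/=; ring.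
  have dh1 : is_derive (0 : R) 1 h1
      (2 * dot u u + 2 * ('D_u f x0 * 'D_u f x0 + (f x0 - z) * 'D_u (fun y => 'D_u f y) x0)).
    have Ux00 : U (x0 + 0 *: u) by rewrite scale0r addr0.
    have dl := @is_derive_line _ _ f x0 u 0 (df Ux00).
    have dl2 : is_derive (0 : R) 1 (fun t => 'D_u f (x0 + t *: u))
        ('D_u (fun y => 'D_u f y) (x0 + 0 *: u)).
      by apply: is_derive_line; case: C2 => _ /(_ u)[d2 _]; exact: d2.
    apply: is_derive_eq.
    rewrite !scale0r !addr0 /GRing.scale/=; ring.
  have [||H1 H2] := @second_derivative_test _ h h1 _ d _ dh dh1 _.
  - by rewrite lt_min e0.
  (* The graph stays below the hemisphere, hence outside the ball bounded by the sphere. *)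
  - move=> t /inB tB; rewrite [h t]hE [h 0]hE scale0r addr0 -aD.
    have -> : f x0 - z = - s by rewrite /z opprD addrA subrr sub0r.
    rewrite sqrrN sE addrC subrK.
    have := x0max _ tB; rewrite -/z; set y := x0 + _ => yz.
    have yr : dot (y - c) (y - c) <= r ^+ 2 by rewrite -enorm_le.
    have : depth y ^+ 2 <= (z - f y) ^+ 2.
      have yz' : depth y <= z - f y by lra.
      by rewrite ler_pXn2r ?nnegrE ?sqrtr_ge0// (le_trans (sqrtr_ge0 _) yz').
    rewrite sqr_sqrtr ?subr_ge0// -[(z - _) ^+ 2]sqrrN opprB; lra.
  split.
    by move: H1; rewrite /h1 mulr0 mul0r addr0 scale0r addr0; lra.
  by rewrite expr2; lra.
have fz : f x0 - z = - s by rewrite /z opprD addrA subrr sub0r.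
(* First order: the sphere and the graph share their normal, which also yields
   [s = r / sqrt slope]. *)
have aE : a = s *: grad f x0.
  apply/rowP => i; have [+ _] := key (delta_mx 0 i).
  rewrite fz dot_delta mulNr => /eqP; rewrite subr_eq0 => /eqP ->.
  by rewrite !mxE.
have rE : r ^+ 2 = s ^+ 2 * slope f x0.
  have aa : dot a a = s ^+ 2 * dot (grad f x0) (grad f x0).
    by rewrite aE dotZl dotZr mulrA -expr2.
  by rewrite /slope mulrDr mulr1 -aa sE; ring.
have sl0 := slope_gt0 f x0.
have rs : r = s * Num.sqrt (slope f x0).
  apply/eqP; rewrite -(@eqrXn2 _ 2)// ?mulr_ge0 ?sqrtr_ge0 ?ltW//.
  by rewrite exprMn (sqr_sqrtr (ltW sl0)) rE.
move=> u; have [_] := key u; rewrite fz (derive2_hess oU C2)// derive_grad; last exact: df.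
rewrite (dotC _ u) => H.
have q0 : 0 < Num.sqrt (slope f x0) by rewrite sqrtr_gt0.
rewrite {1}rs invfM mulrCA divff ?mulr1; last by rewrite gt_eqF.
by rewrite ler_pdivlMl//; lra.
Qed.

End Hemisphere.

(** * Constancy of the signature *)

Section Opposite.
Context {R : realType} {m : nat} (U : set 'rV[R]_m).
Hypothesis oU : open U.

(** Stated for functions opposite on [U] only, so as to apply again to their derivatives. *)
Lemma derive_opp_on (g h : 'rV[R]_m -> R) v x :
  (forall y, U y -> differentiable g y) -> (forall y, U y -> h y = - g y) ->
  U x -> 'D_v h x = - 'D_v g x.
Proof.
move=> dg hg Ux.
rewrite (@near_eq_derive _ _ _ _ (- g)).
  by apply: deriveN; exact/diff_derivable/dg.
by have : nbhs x U by [exact: open_nbhs_nbhs]; apply: filterS => y /hg.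
Qed.

Lemma C1_on_opp (g h : 'rV[R]_m -> R) :
  (forall y, U y -> h y = - g y) -> C1_on U g -> C1_on U h.
Proof.
move=> hg [dg cg]; split=> [x Ux|v x Ux].
  apply: (@near_eq_differentiable _ _ _ _ (- g)); last exact/differentiableN/dg.
  by have : nbhs x U by [exact: open_nbhs_nbhs]; apply: filterS => y /hg.
have Dh := derive_opp_on v dg hg.
rewrite /prop_for /continuous_at Dh//.
have cN := @continuousN _ _ _ _ x (cg v x Ux).
apply: cvg_trans cN.
apply: (@near_eq_cvg _ _ (nbhs x)).
have : nbhs x U by exact: open_nbhs_nbhs.
by apply: filterS => y Uy; rewrite Dh.
Qed.

(** A hemisphere lifted from below is, after reflection, one lowered onto the graph of [- f]. *)
Lemma C2_on_opp (f : 'rV[R]_m -> R) : C2_on U f -> C2_on U (- f).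
Proof.
move=> [C1 C2]; split; first exact: (@C1_on_opp f).
move=> v; apply: (C1_on_opp _ (C2 v)) => y.
by apply: derive_opp_on => //; case: C1.
Qed.

Lemma grad_opp (f : 'rV[R]_m -> R) x : C2_on U f -> U x ->
  grad (- f) x = - grad f x.
Proof.
move=> [[df _] _] Ux; apply/rowP => i; rewrite !mxE.
by rewrite (@derive_opp_on f).
Qed.

Lemma hess_opp (f : 'rV[R]_m -> R) x : C2_on U f -> U x ->
  hess (- f) x = - hess f x.
Proof.
move=> [[df _] C2] Ux; apply/matrixP => i j; rewrite !mxE.
apply: derive_opp_on => //; first by case: (C2 (delta_mx 0 j)).
by move=> y; apply: derive_opp_on.
Qed.

End Opposite.

(** Connectedness of the segment: the points where [P] holds form a nonempty, relatively open and
    closed subset. *)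
Lemma locally_constant_segment {R : realType} (P : R -> Prop) :
  (forall t : R, 0 <= t <= 1 -> \forall s \near t, 0 <= s <= 1 -> (P s <-> P t)) ->
  P 0 -> P 1.
Proof.
move=> loc P0.
pose I : set R := `[0, 1]%classic.
pose B := I `&` [set t | P t].
have IE t : I t = (0 <= t <= 1) by rewrite /I/= in_itv.
suff BI : B = I.
  have : I 1 by rewrite IE ler01 lexx.
  by rewrite -BI => -[].
apply: (@segment_connected R 0 1).
- by exists 0; split=> //; rewrite IE lexx ler01.
- exists (interior [set s | I s -> P s]); first exact: open_interior.
  apply/seteqP; split=> t [It Pt]; split=> //; last exact: (nbhs_singleton Pt).
  have It' : 0 <= t <= 1 by rewrite -IE.
  apply: filterS (loc t It') => s H; rewrite /= IE => /H sP.
  exact/sP.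
- exists (~` interior [set s | I s -> ~ P s]); first exact/open_closedC/open_interior.
  apply/seteqP; split=> t [It Pt]; split=> //.
    by move=> /nbhs_singleton/= /(_ It); apply.
  apply: contrapT => nPt; apply: Pt.
  have It' : 0 <= t <= 1 by rewrite -IE.
  apply: filterS (loc t It') => s H; rewrite /= IE => /H sP Ps.
  exact/nPt/sP.
Qed.

(** * Principal frames of the graph and local constancy of the signature *)

Section Graph.
Context {R : realType} {n : nat}.
Variables (U : set 'rV[R]_n) (f : 'rV[R]_n -> R) (N : 'rV[R]_n -> 'rV[R]_(n + 1)).
Hypotheses (oU : open U) (C2 : C2_on U f) (hN : unit_normal_field U f N).

Lemma metric_form x u : U x ->
  dot (u *m metric_mx f x) u = dot u u + dot u (grad f x) ^+ 2.
Proof.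
move=> Ux; rewrite -dot_tangent (tangentE C2)// dot_row_mx dot_scalar -expr2 derive_gradC//.
by case: C2 => -[df _] _; exact: df.
Qed.

(* The k i are the principal curvatures up to a common sign, the one of the
   angle between N and the upward direction. *)
Lemma principal_frame x : (1 < n)%N -> U x ->
  (forall v, enorm (tangent f x v) = 1 -> ricci f N x v < 0) ->
  exists (E : 'M[R]_n) (k : 'rV[R]_n),
    [/\ E *m metric_mx f x *m E^T = 1%:M,
        E *m hess f x *m E^T = diag_mx (Num.sqrt (slope f x) *: k),
        sff_length f N x = Num.sqrt (\sum_i k 0 i ^+ 2) &
        forall i, k 0 i * (\sum_j k 0 j - k 0 i) < 0].
Proof.
move=> n1 Ux neg; have n0 : (0 < n)%N by exact: ltnW.
pose eta := N x 0 (rshift n 0); pose W := Num.sqrt (slope f x).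
have W0 : 0 < W by rewrite sqrtr_gt0 slope_gt0.
have etaW : `|eta| = W^-1 by rewrite (norm_eta C2 hN).
have SG := shape_mx_hess oU C2 hN Ux; rewrite -/eta in SG.
have Gs : (metric_mx f x)^T = metric_mx f x by rewrite /metric_mx trmx_mul trmxK.
have [|E [d [EG EH]]] := simultaneous_diagonalization Gs (hess_sym oU C2 Ux).
  move=> u u0; rewrite metric_form//.
  by rewrite ltr_wpDr ?sqr_ge0// dot_gt0.
have GEE : metric_mx f x *m E^T *m E = 1%:M.
  by apply: mulmx1C; rewrite mulmxA.
have ES : E *m shape_mx f N x = diag_mx (eta *: d) *m E.
  have -> : shape_mx f N x = shape_mx f N x *m metric_mx f x *m E^T *m E.
    by rewrite -[LHS]mulmx1 -GEE !mulmxA.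
  by rewrite SG -!scalemxAl -scalemxAr !mulmxA EH linearZ/= -scalemxAl.
(* The length of the second fundamental form and the Ricci condition are unchanged when all
   curvatures change sign, so [sg] drops out. *)
pose sg := Num.sg eta.
have sg2 : sg ^+ 2 = 1.
  by rewrite sqr_sg; have := (eta_neq0 C2 hN Ux); rewrite -/eta => ->.
have kE i : (eta *: d) 0 i = sg * (W^-1 *: d) 0 i.
  by rewrite !mxE -etaW mulrA /sg -numEsg.
exists E, (W^-1 *: d); split=> //.
- by rewrite scalerA divff ?scale1r// gt_eqF.
- rewrite /sff_length (tr_shape_mx2 EG ES); congr Num.sqrt; apply: eq_bigr => i _.
  by rewrite kE exprMn sg2 mul1r.
- move=> i; have := neg (row i E); rewrite /enorm (frame_norm EG) sqrtr1 => /(_ erefl).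
  rewrite (ricci_frame EG ES)// kE; under eq_bigr do rewrite kE.
  rewrite -mulr_sumr -mulrBr mulrACA -expr2 sg2 mul1r.
  by rewrite ltr_pdivrMr ?mul0r// subr_gt0 ltr1n.
Qed.

(** In the frame [E] the Hessian is exactly diagonal, and no [k i] vanishes, so the perturbation
    lemma applies with error [0]. *)
Lemma neg2_frame x (E : 'M[R]_n) (k : 'rV[R]_n) :
  E *m metric_mx f x *m E^T = 1%:M ->
  E *m hess f x *m E^T = diag_mx (Num.sqrt (slope f x) *: k) ->
  (forall i, k 0 i * (\sum_j k 0 j - k 0 i) < 0) ->
  (exists i j, [/\ i != j, k 0 i < 0 & k 0 j < 0]) <-> neg2 (hess f x).
Proof.
move=> EG EH kneg.
have W0 : 0 < Num.sqrt (slope f x) by rewrite sqrtr_gt0 slope_gt0.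
have k0 i : k 0 i != 0 by apply: contraTneq (kneg i) => ->; rewrite mul0r ltxx.
have sgn i : ((Num.sqrt (slope f x) *: k) 0 i < 0) = (k 0 i < 0) by rewrite mxE pmulr_rlt0.
rewrite -(neg2_congr _ (frame_unit EG)) EH.
rewrite (@neg2_near_diag _ _ _ (Num.sqrt (slope f x) *: k) 0).
- by split=> -[i [j [ij ki kj]]]; exists i, j; split=> //; rewrite ?sgn// -sgn.
- by move=> i; rewrite mulr0 normr_gt0 mxE mulf_neq0// gt_eqF.
- by move=> i j; rewrite subrr normr0.
Qed.

(** The frame [E] of [x] is kept at nearby points: there the Hessian is almost diagonal in it, with
    diagonal entries bounded away from [0]. *)
Lemma neg2_hess_locally_constant x (E : 'M[R]_n) (k : 'rV[R]_n) : U x ->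
  E *m metric_mx f x *m E^T = 1%:M ->
  E *m hess f x *m E^T = diag_mx (Num.sqrt (slope f x) *: k) ->
  (forall i, k 0 i * (\sum_j k 0 j - k 0 i) < 0) ->
  \forall y \near x, neg2 (hess f y) <-> neg2 (hess f x).
Proof.
move=> Ux EG EH kneg.
have W0 : 0 < Num.sqrt (slope f x) by rewrite sqrtr_gt0 slope_gt0.
have k0 i : k 0 i != 0 by apply: contraTneq (kneg i) => ->; rewrite mul0r ltxx.
pose d := Num.sqrt (slope f x) *: k.
have d0 i : 0 < `|d 0 i| by rewrite normr_gt0 mxE mulf_neq0// gt_eqF.
have dE i j : diag_mx d i j = (E *m hess f x *m E^T) i j by rewrite EH.
pose mu := \big[Num.min/1]_i `|d 0 i|.
have mu0 : 0 < mu by apply/bigmin_gtP; split.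
have mud i : mu <= `|d 0 i| by exact: bigmin_le_cond.
(* Chosen so that [n * e < mu], the threshold of [neg2_near_diag]. *)
pose e := mu / (n%:R + 1).
have n10 : 0 < n%:R + 1 :> R by rewrite ltr_wpDl.
have e0 : 0 < e by rewrite divr_gt0.
have ed i : n%:R * e < `|d 0 i|.
  apply: lt_le_trans (mud i); rewrite /e mulrA ltr_pdivrMr// mulrC.
  by rewrite mulrDr mulr1 ltrDl.
have cE : {for x, continuous (fun y => E *m hess f y *m E^T)}.
  apply: (@continuous_comp _ _ _ (hess f) (fun A : 'M[R]_n => E *m A *m E^T)).
    exact: (continuous_hess C2).
  apply: (@continuous_comp _ _ _ (fun A : 'M[R]_n => E *m A) (fun A : 'M[R]_n => A *m E^T)).
    exact: continuous_mulmx.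
  exact: continuous_mulmxr.
have near_e : \forall y \near x,
    forall i j, `|(E *m hess f y *m E^T) i j - diag_mx d i j| <= e.
  pose T y i j := `|(E *m hess f y *m E^T) i j - diag_mx d i j| <= e.
  apply: (@filter_forall _ _ (fun i y => forall j, T y i j) (nbhs x)) => i.
  apply: (@filter_forall _ _ (fun j y => T y i j) (nbhs x)) => j; rewrite /T.
  have cij : {for x, continuous (fun y => (E *m hess f y *m E^T) i j)}.
    apply: (@continuous_comp _ _ _ (fun y => E *m hess f y *m E^T)
      (fun A : 'M[R]_n => A i j)) => //.
    exact: coord_continuous.
  have /cvgr_dist_le/(_ _ e0) := cij; apply: filterS => y ye.
  by rewrite dE distrC; exact: ye.
apply: filterS near_e => y ye.
apply: iff_trans (iff_sym (neg2_congr (hess f y) (frame_unit EG))) _.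
apply: iff_trans (neg2_near_diag ed ye) _.
apply: iff_trans (neg2_frame EG EH kneg).
have sgn i : (d 0 i < 0) = (k 0 i < 0) by rewrite mxE pmulr_rlt0.
by split=> -[i [j [ij ki kj]]]; exists i, j; split=> //; rewrite ?sgn// -sgn.
Qed.

End Graph.

(** * The estimate *)

Section Conclusion.
Context {R : realType} {n : nat}.
Variables (r : R) (c : 'rV[R]_n) (U : set 'rV[R]_n) (f : 'rV[R]_n -> R)
  (N : 'rV[R]_n -> 'rV[R]_(n + 1)).
Hypotheses (n3 : (3 <= n)%N) (r0 : 0 < r) (oU : open U)
  (BU : closed_eball c r `<=` U) (C2 : C2_on U f)
  (hN : unit_normal_field U f N) (neg : negative_ricci (closed_eball c r) f N).

(** From [|(1 - t) a + t b|^2 = (1 - t) |a|^2 + t |b|^2 - t (1 - t) |a - b|^2]. *)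
Lemma closed_eball_segment p q (t : R) : closed_eball c r p -> closed_eball c r q ->
  0 <= t <= 1 -> closed_eball c r (p + t *: (q - p)).
Proof.
have r0' := ltW r0; rewrite /closed_eball/= !enorm_le// => pr qr /andP[t0 t1].
set a := p - c in pr; set b := q - c in qr.
have -> : p + t *: (q - p) - c = (1 - t) *: a + t *: b.
  by apply/rowP => i; rewrite !mxE; ring.
clearbody a b; have := dot_ge0 (a - b).
rewrite !(dotBl, dotBr, dotDl, dotDr, dotZl, dotZr) (dotC b a) => ab.
have H : 0 <= dot a a + dot b b - 2 * dot a b by lra.
have t1' : 0 <= 1 - t by rewrite subr_ge0.
have := mulr_ge0 (mulr_ge0 t0 t1') H.
move: pr qr; rewrite -!(subr_ge0 _ (r ^+ 2)) => /(mulr_ge0 t1') + /(mulr_ge0 t0).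
by lra.
Qed.

(** The segment from [p] to [q] stays in the ball, where negative Ricci curvature makes the property
    locally constant. *)
Lemma neg2_hess_ball p q : closed_eball c r p -> closed_eball c r q ->
  neg2 (hess f p) -> neg2 (hess f q).
Proof.
move=> pB qB; pose x (t : R) := p + t *: (q - p).
have xB (t : R) : 0 <= t <= 1 -> closed_eball c r (x t) by exact: closed_eball_segment.
have cx : continuous x.
  move=> t; apply: continuous_mx => i j; rewrite /x.
  rewrite (_ : (fun _ => _) = fun s => p i j + s * (q - p) i j); last first.
    by apply/funext => s; rewrite 3!mxE.
  apply: continuousD; first exact: cst_continuous.
  by apply: continuousM => //; exact: cst_continuous.
have := @locally_constant_segment R (fun t => neg2 (hess f (x t))) _.
rewrite /x scale0r addr0 scale1r subrKC; apply => t t01.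
have xtB := xB t t01.
have [E [k [EG EH _ kneg]]] :=
  principal_frame oU C2 hN (ltnW n3) (BU xtB) (fun v => neg xtB (v := v)).
have nb := neg2_hess_locally_constant C2 (BU xtB) EG EH kneg.
have near_t : \forall s \near t, neg2 (hess f (x s)) <-> neg2 (hess f (x t)).
  exact: (cx t _ nb).
by apply: filterS near_t => s H _.
Qed.

(** The sign [s] is [1] for contact from above and [-1] for contact from below. *)
Lemma sff_length_bound x (k : 'rV[R]_n) (s : R) (i j : 'I_n) :
  sff_length f N x = Num.sqrt (\sum_l k 0 l ^+ 2) -> s ^+ 2 = 1 ->
  (forall l, s * k 0 l <= r^-1) ->
  (forall l, k 0 l * (\sum_m k 0 m - k 0 l) < 0) ->
  i != j -> s * k 0 i < 0 -> s * k 0 j < 0 ->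
  sff_length f N x < 3 * (n%:R - 2) / r.
Proof.
move=> -> s1 kr kneg ij ki kj.
have ric l : s * k 0 l * (\sum_m s * k 0 m - s * k 0 l) < 0.
  by rewrite -mulr_sumr -mulrBr mulrACA -expr2 s1 mul1r.
have := curvature_sum_le ric kr ij ki kj n3.
under eq_bigr do rewrite exprMn s1 mul1r.
have m1 : 1 <= n%:R - 2 :> R.
  by rewrite lerBrDr -(natrD _ 1 2) ler_nat.
have -> : 3 * (n%:R - 2) / r = Num.sqrt ((3 * (n%:R - 2) / r) ^+ 2).
  by rewrite sqrtr_sqr ger0_norm// !mulr_ge0 ?invr_ge0 ?ltW// (lt_le_trans ltr01).
have q0 : 0 < (n%:R - 2) ^+ 2 * r^-1 ^+ 2.
  by rewrite mulr_gt0 ?exprn_gt0 ?invr_gt0// (lt_le_trans ltr01).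
move=> H; rewrite ltr_sqrt; last first.
  by rewrite exprn_gt0// !mulr_gt0 ?invr_gt0// (lt_le_trans ltr01).
apply: le_lt_trans H _.
(* Strictness comes from [3 < 9]: the squared length is at most [3 (n - 2)^2 / r^2]. *)
rewrite (_ : (_ / _) ^+ 2 = 9 * ((n%:R - 2) ^+ 2 * r^-1 ^+ 2)); last by ring.
by rewrite -mulrA ltr_pM2r// ltr_nat.
Qed.

Lemma exists_sff_length_lt : exists2 x, closed_eball c r x &
  sff_length f N x < 3 * (n%:R - 2) / r.
Proof.
have frame x (xB : closed_eball c r x) :=
  principal_frame oU C2 hN (ltnW n3) (BU xB) (fun v => neg xB (v := v)).
have norm1 x (E : 'M[R]_n) i : U x -> E *m metric_mx f x *m E^T = 1%:M ->
    dot (row i E) (row i E) + dot (row i E) (grad f x) ^+ 2 = 1.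
  by move=> Ux EG; rewrite -(metric_form C2)// -dot_tangent (frame_norm EG).
have diagE x (E : 'M[R]_n) (k : 'rV[R]_n) i :
    E *m hess f x *m E^T = diag_mx (Num.sqrt (slope f x) *: k) ->
    dot (row i E *m hess f x) (row i E) = Num.sqrt (slope f x) * k 0 i.
  move=> EH; transitivity ((E *m hess f x *m E^T) i i).
    rewrite dotE -row_mul tr_row mxE [RHS]mxE.
    by apply: eq_bigr => l _; rewrite !mxE.
  by rewrite EH !mxE eqxx.
have W0 x : 0 < Num.sqrt (slope f x) by rewrite sqrtr_gt0 slope_gt0.
have [x0 x0B touch0] := hemisphere_touching oU C2 r0 BU.
have [E0 [k0 [EG0 EH0 len0 kneg0]]] := frame _ x0B.
(* The touching inequality, evaluated on a principal vector that is a unit vector for the metric. *)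
have k0r l : 1 * k0 0 l <= r^-1.
  have := touch0 (row l E0); rewrite (diagE _ _ _ _ EH0) norm1 ?mulr1//; last exact: BU.
  by rewrite ler_pM2l// mul1r.
have [two|nottwo] := pselect (neg2 (hess f x0)).
  have [i [j [ij ki kj]]] := iffRL (neg2_frame EG0 EH0 kneg0) two.
  exists x0 => //; apply: (sff_length_bound len0 _ k0r kneg0 ij);
    by rewrite ?mul1r ?expr1n.
(* Otherwise use contact from below; constancy of the signature carries the failure of [neg2] from
   [x0] to [x1]. *)
have [x1 x1B touch1] := hemisphere_touching oU (C2_on_opp oU C2) r0 BU.
have [E1 [k1 [EG1 EH1 len1 kneg1]]] := frame _ x1B.
have Ux1 := BU x1B.
have sl1 : slope (- f) x1 = slope f x1.
  by rewrite /slope (grad_opp oU)// dotNl dotNr opprK.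
have k1r l : - 1 * k1 0 l <= r^-1.
  have := touch1 (row l E1).
  rewrite (hess_opp oU C2)// (grad_opp oU C2)// mulmxN dotNl dotNr sqrrN sl1.
  rewrite (diagE _ _ _ _ EH1) norm1// mulr1 mulN1r -mulrN.
  by rewrite ler_pM2l.
have nottwo1 : ~ exists i j, [/\ i != j, k1 0 i < 0 & k1 0 j < 0].
  move=> /(neg2_frame EG1 EH1 kneg1) H; apply: nottwo.
  exact: neg2_hess_ball x1B x0B H.
have k1n i : k1 0 i != 0 by apply: contraTneq (kneg1 i) => ->; rewrite mul0r ltxx.
(* Among three nonzero curvatures at most one is negative, so two are positive. *)
have [i [j [ij ki kj]]] : exists i j, [/\ i != j, 0 < k1 0 i & 0 < k1 0 j].
  pose o (a : nat) (a3 : (a < 3)%N) := Ordinal (leq_trans a3 n3).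
  have pos i j : i != j -> 0 < k1 0 i \/ 0 < k1 0 j.
    move=> ij; have := k1n i; rewrite neq_lt => /orP[ki|]; last by left.
    have := k1n j; rewrite neq_lt => /orP[kj|]; last by right.
    by exfalso; apply: nottwo1; exists i, j.
  have [] := pos (o 0%N isT) (o 1%N isT) isT; have [] := pos (o 0%N isT) (o 2 isT) isT;
    have [] := pos (o 1%N isT) (o 2 isT) isT => *;
    by [exists (o 0%N isT), (o 1%N isT) | exists (o 0%N isT), (o 2 isT) |
        exists (o 1%N isT), (o 2 isT)].
exists x1 => //; apply: (sff_length_bound len1 _ k1r kneg1 ij).
- by rewrite sqrrN expr1n.
- by rewrite mulN1r oppr_lt0.
- by rewrite mulN1r oppr_lt0.
Qed.

End Conclusion.

Theorem theorem1p4 (R : realType) (n : nat) (r : R) (c : 'rV[R]_n)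
    (U : set 'rV[R]_n) (f : 'rV[R]_n -> R) (N : 'rV[R]_n -> 'rV[R]_(n + 1)) :
  (3 <= n)%N -> 0 < r ->
  open U -> closed_eball c r `<=` U -> C2_on U f ->
  unit_normal_field U f N ->
  negative_ricci (closed_eball c r) f N ->
  inf [set sff_length f N x | x in closed_eball c r] < 3 * (n%:R - 2) / r.
Proof.
move=> n3 r0 oU BU C2 hN neg.
have [x xB xlt] := exists_sff_length_lt n3 r0 oU BU C2 hN neg.
apply: le_lt_trans xlt; apply: ge_inf; last by exists x.
by exists 0 => _ [y _ <-]; exact: sqrtr_ge0.
Qed.
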